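(* There exist functions $\varepsilon_1,\varepsilon_2:(0,1)\to\mathbb{R}$ with $\lim_{\beta\to 0^+}\varepsilon_1(\beta)=\lim_{\beta\to 0^+}\varepsilon_2(\beta)=0$ such that for every real $0<\beta<1$ the following two statements hold. (1) There is a set $A$ of positive integers with $\gcd(A)=1$ and upper density $\beta$ satisfying $$\limsup_{n\to\infty}\frac{\log p_A(n)}{\log p(\beta n)}\leq \frac{\sqrt{6}\,\log 2}{\pi}+\varepsilon_1(\beta).$$ (2) Every set $A$ of positive integers of upper density $\beta$ satisfies $$\limsup_{n\to\infty}\frac{\log p_A(n)}{\log p(\beta n)}\geq \frac{\sqrt{6}\,\log 2}{\pi}+\varepsilon_2(\beta).$$
   Context: For a set $A$ of positive integers, $p_A(n)$ denotes the number of partitions of $n$ using integers from $A$, i.e. the number of multisets of elements of $A$ (repetitions allowed, order irrelevant) whose sum is $n$. $p(n)=p_{\{1,2,3,\ldots\}}(n)$ is the usual partition function, and $p(\beta n)$ means $p(\lfloor \beta n\rfloor)$. Logarithms are natural; $\log 0=-\infty$, and limits superior are taken in the extended reals (only large $n$, for which $\log p(\lfloor\beta n\rfloor)>0$, matter). The upper density of $A$ is $\limsup_{n\to\infty}|A\cap\{1,\ldots,n\}|/n$. $\gcd(A)$ is the greatest common divisor of all elements of $A$. The notation $o_\beta(1)$ in the source means a quantity depending on $\beta$ that tends to $0$ as $\beta\to 0$; it is written out here as the functions $\varepsilon_1,\varepsilon_2$. *)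

(* Defs.v *)
From HB Require Import structures.
From mathcomp Require Import all_boot all_order all_algebra.
From mathcomp Require Import all_classical all_reals all_analysis.
Set Implicit Arguments.
Unset Strict Implicit.
Unset Printing Implicit Defensive.
Import Order.TTheory GRing.Theory Num.Theory.
Import numFieldNormedType.Exports.

Definition positives : set nat := [set k : nat | (0 < k)%N]%classic.

(* A multiset of parts is given by its multiplicity function.  When all parts
   are positive and sum to n, both the parts and the multiplicities are at most
   n, so nothing is lost by the bounds in the type.  This is the partition
   function only for A `<=` positives. *)
Definition partitions_in (A : set nat) (n : nat) : {set {ffun 'I_n.+1 -> 'I_n.+1}} :=
  [set m : {ffun 'I_n.+1 -> 'I_n.+1} |
     ((\sum_(i < n.+1) m i * i)%N == n)
     && [forall i : 'I_n.+1, (0 < m i)%N ==> ((i : nat) \in A)]].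

Definition pA (A : set nat) (n : nat) : nat := #|partitions_in A n|.

Definition p (n : nat) : nat := pA positives n.

Definition is_gcd (A : set nat) (g : nat) : Prop :=
  (forall a, A a -> (g %| a)%N) /\
  (forall d, (forall a, A a -> (d %| a)%N) -> (d %| g)%N).

Definition count_upto (A : set nat) (n : nat) : nat :=
  count (fun k => k \in A) (iota 1 n).

Definition upper_density (R : realType) (A : set nat) : \bar R :=
  limn_esup (fun n => ((count_upto A n)%:R / n%:R)%R%:E).

(* lne 0 = -oo.  The denominator is positive and finite for all large n when
   0 < beta; the finitely many other terms do not affect the limsup. *)
Definition log_ratio (R : realType) (A : set nat) (beta : R) (n : nat) : \bar R :=
  (lne (pA A n)%:R%:E / lne (p (Num.truncn (beta * n%:R)%R))%:R%:E)%E.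

(* Main.v *)
Require Import Defs.
From mathcomp Require Import all_boot all_order all_algebra.
From mathcomp Require Import all_classical all_reals all_analysis.
From mathcomp Require Import lra ring zify.
Import Order.TTheory GRing.Theory Num.Theory.
Import numFieldNormedType.Exports.
Local Open Scope classical_set_scope.
Local Open Scope ring_scope.

(* Everything rests on comparing p_A with its generating function
   F(x) = sum_n p_A(n) x^n = prod_(a in A) 1/(1 - x^a) at x = e^(-t), t -> 0.

   For A = all positive integers, log F(e^(-t)) ~ zeta(2)/t; the upper bound gives
   p(n) <= exp(2 sqrt(zeta(2) n)), and since this makes the terms of F with m far
   from zeta(2)/t^2 negligible, a Tauberian argument (p is nondecreasing) gives the
   matching lower bound.  With zeta(2) = pi^2/6 the theorem says that the optimal
   growth is log p_A(n) ~ 2 log 2 sqrt(beta n).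

   Lower bound for every A: if log p_A(n) <= l sqrt n eventually, then
   log F(e^(-t)) <= l^2/(4t) (1 + o(1)), whereas the parts a <= N alone contribute
   |A cap [1,N]| log 2 at t = (log 2)/N; so the upper density is at most
   l^2/(4 log^2 2).

   Extremal A: the union of the blocks ((1 - beta) N_k, N_k] with N_(k+1) = N_k^4.
   Only one block matters for a given n, and optimising t in
   p_A(n) <= e^(tn) F(e^(-t)) gives an entropy bounded by 2 log 2 sqrt(SM), with
   S = n/((1 - beta) N_k) and M = beta N_k + 1; the loss is the factor
   1/sqrt(1 - beta). *)

(** * Generating functions of restricted partitions *)

Lemma in_partitions (A : set nat) (n : nat) (m : {ffun 'I_n.+1 -> 'I_n.+1}) :
  (m \in partitions_in A n) = ((\sum_(i < n.+1) m i * i)%N == n)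
     && [forall i : 'I_n.+1, (0 < m i)%N ==> ((i : nat) \in A)].
Proof. by rewrite inE. Qed.

Lemma sum_ord_zero_tail (F : nat -> nat) (a b : nat) :
  (forall i, (a <= i)%N -> F i = 0%N) -> (forall i, (b <= i)%N -> F i = 0%N) ->
  (\sum_(i < a) F i)%N = (\sum_(i < b) F i)%N.
Proof.
wlog ab : a b / (a <= b)%N.
  by move=> H Fa Fb; case/orP: (leq_total a b) => ?; [|symmetry]; exact: H.
move=> Fa _; rewrite -!(big_mkord xpredT) (big_cat_nat (leq0n a) ab) //=.
by rewrite [X in (_ + X)%N]big_nat_cond [X in (_ + X)%N]big1 ?addn0// => i /andP[/andP[/Fa]].
Qed.

(** In a multiplicity function of weight [m] on positive integers, parts and multiplicities are at
    most [m], so the encoding in ['I_m.+1] loses nothing. Passing through [nat -> nat] lets counts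
    over different bounded types be compared. *)
Lemma card_le_pA (T : finType) (S : {set T}) (phi : T -> nat -> nat)
    (A : set nat) (B m : nat) :
  A `<=` positives ->
  (forall f i, f \in S -> (0 < phi f i)%N -> i \in A) ->
  (forall f i, f \in S -> (B <= i)%N -> phi f i = 0%N) ->
  (forall f, f \in S -> (\sum_(i < B) phi f i * i)%N = m) ->
  {in S &, forall f g, phi f =1 phi g -> f = g} ->
  (#|S| <= pA A m)%N.
Proof.
move=> Apos phiA phiB phim phi_inj.
have phi0 f : f \in S -> phi f 0%N = 0%N.
  move=> fS; apply/eqP; rewrite -leqn0 leqNgt; apply/negP => /(phiA _ _ fS).
  by rewrite in_setE => /Apos.
have phi_mul f i : f \in S -> (phi f i * i <= m)%N.
  move=> fS; have [iB|Bi] := ltnP i B; last by rewrite phiB.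
  by rewrite -(phim _ fS) (bigD1 (Ordinal iB)) //= leq_addr.
have phi_le f i : f \in S -> (phi f i < m.+1)%N.
  move=> fS; case: i => [|i]; first by rewrite phi0.
  by rewrite ltnS; apply: leq_trans (phi_mul f i.+1 fS); rewrite leq_pmulr.
have phi_gt f i : f \in S -> (m < i)%N -> phi f i = 0%N.
  move=> fS mi; apply/eqP; rewrite -leqn0 leqNgt; apply/negP => p0.
  have := phi_mul f i fS; rewrite leqNgt => /negP; apply.
  by apply: leq_trans mi _; rewrite leq_pmull.
pose psi f : {ffun 'I_m.+1 -> 'I_m.+1} := [ffun i : 'I_m.+1 => inord (phi f i)].
have psiE f (i : 'I_m.+1) : f \in S -> psi f i = phi f i :> nat.
  by move=> fS; rewrite ffunE inordK// phi_le.
have psi_inj : {in S &, injective psi}.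
  move=> f g fS gS fg; apply: phi_inj => // i.
  have [im|mi] := ltnP i m.+1; last by rewrite !phi_gt.
  by rewrite -(psiE f (Ordinal im)) // -(psiE g (Ordinal im)) // fg.
rewrite -(card_in_imset psi_inj); apply/subset_leq_card/fintype.subsetP => _ /imsetP[f fS ->].
rewrite in_partitions; apply/andP; split.
  apply/eqP; rewrite (eq_bigr (fun i : 'I_m.+1 => phi f i * i)%N); last first.
    by move=> i _; rewrite psiE.
  rewrite -[RHS](phim _ fS).
  apply: (sum_ord_zero_tail (fun i => phi f i * i)%N) => i ?.
    by rewrite phi_gt.
  by rewrite phiB.
by apply/forallP => i; rewrite psiE//; apply/implyP => /phiA; apply.
Qed.

Lemma leq_p (m n : nat) : (m <= n)%N -> (p m <= p n)%N.
Proof.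
elim: n => [|n IH]; first by rewrite leqn0 => /eqP ->.
rewrite leq_eqVlt => /orP[/eqP -> //|]; rewrite ltnS => /IH/leq_trans; apply.
pose ext (f : {ffun 'I_n.+1 -> 'I_n.+1}) i :=
  (if insub i is Some j then f j : nat else 0)%N.
have extE f (i : 'I_n.+1) : ext f i = f i by rewrite /ext valK.
have ext0 f i : (n < i)%N -> ext f i = 0%N.
  by move=> ni; rewrite /ext insubF// ltnNge; apply/negbTE; rewrite negbK.
(* Adding a part equal to 1 is injective. *)
apply: (@card_le_pA _ _ (fun f i => ext f i + (i == 1))%N _ n.+2); first by [].
- move=> f i; rewrite in_partitions => /andP[_ /forallP fA].
  rewrite in_setE /positives /= lt0n; case: i => [|//]; rewrite addn0.
  by rewrite (extE f ord0) => f0; have := fA ord0; rewrite lt0n f0 /= in_setE.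
- by move=> f [|[|i]] _ ni //; rewrite ext0 // ltnW.
- move=> f; rewrite in_partitions => /andP[/eqP fn _].
  under eq_bigr do rewrite mulnDl.
  rewrite big_split -[RHS]addn1.
  congr (_ + _)%N.
    rewrite -[RHS]fn big_ord_recr /= ext0// mul0n addn0.
    by apply: eq_bigr => i _; rewrite extE.
  by rewrite 2!big_ord_recl /= big1.
move=> f g _ _ fg; apply/ffunP => i; apply/val_inj => /=.
by have := fg i; rewrite !extE => /addIn.
Qed.

(** Distributivity: choosing a term [j] in every factor is choosing a multiplicity function, and a
    factor with [i] outside [A] offers only [j = 0]. *)
Lemma prod_sum_weight (R : realType) (x : R) (A : set nat) (L : nat) :
  \prod_(i < L.+1) (\sum_(j < L.+1 | ((0 < j)%N ==> ((i : nat) \in A))) x ^+ (j * i)) =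
  \sum_(f : {ffun 'I_L.+1 -> 'I_L.+1}
      | [forall i : 'I_L.+1, (0 < f i)%N ==> ((i : nat) \in A)])
    x ^+ (\sum_(i < L.+1) f i * i)%N.
Proof.
rewrite (bigA_distr_big_dep (fun i j : 'I_L.+1 => ((0 < j)%N ==> ((i : nat) \in A)))
   (fun i j : 'I_L.+1 => x ^+ (j * i))) /=.
apply: eq_big => [f|f _].
  by apply/familyP/forallP => H i; have := H i.
by rewrite -prodrXr.
Qed.

Lemma geom_sum (R : realType) (y : R) (n : nat) : y != 1 ->
  \sum_(j < n) y ^+ j = (1 - y ^+ n) / (1 - y).
Proof.
move=> y1; have y1' : 1 - y != 0 by rewrite subr_eq0 eq_sym.
apply: (mulIf y1'); rewrite divfK// -[1 - y ^+ n]opprB subrX1; ring.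
Qed.

Lemma geom_sum_le (R : realType) (y : R) (n : nat) : 0 <= y -> y < 1 ->
  \sum_(j < n) y ^+ j <= (1 - y)^-1.
Proof.
move=> y0 y1; rewrite geom_sum ?lt_eqF//.
by rewrite ler_piMl ?gerBl ?exprn_ge0 ?invr_ge0 ?subr_ge0// ltW.
Qed.

Lemma prod_pos_ord (R : realType) (A : set nat) (L : nat) (F : nat -> R) :
  A `<=` positives ->
  \prod_(1 <= a < L.+1 | a \in A) F a =
  \prod_(i < L.+1) (if (i : nat) \in A then F i else 1).
Proof.
move=> Apos; rewrite -[RHS](big_mkord xpredT (fun i => if i \in A then F i else 1)).
rewrite big_ltn// ifF ?mul1r -?big_mkcond//.
by apply/negbTE/negP; rewrite in_setE => /Apos.
Qed.

(** Partitions of [n] are among the terms of the expanded product of geometric sums cut at [n]; the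
    other terms are nonnegative and each cut sum is at most the full one. *)
Lemma pA_gf_upper (R : realType) (A : set nat) (x : R) (n : nat) :
  A `<=` positives -> 0 <= x -> x < 1 ->
  (pA A n)%:R * x ^+ n <= \prod_(1 <= a < n.+1 | a \in A) (1 - x ^+ a)^-1.
Proof.
move=> Apos x0 x1.
have -> : (pA A n)%:R * x ^+ n =
    \sum_(f in partitions_in A n) x ^+ (\sum_(i < n.+1) f i * i)%N.
  rewrite (eq_bigr (fun=> x ^+ n)); last by move=> f; rewrite in_partitions => /andP[/eqP ->].
  by rewrite sumr_const mulr_natl.
rewrite prod_pos_ord //.
apply: (@le_trans _ _ (\prod_(i < n.+1)
   (\sum_(j < n.+1 | ((0 < j)%N ==> ((i : nat) \in A))) x ^+ (j * i)))).
  rewrite prod_sum_weight [leRHS](bigID (mem (partitions_in A n))) /=.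
  rewrite -[leLHS]addr0 lerD ?sumr_ge0//; last by move=> *; rewrite exprn_ge0.
  rewrite le_eqVlt; apply/orP; left; apply/eqP/eq_bigl => f.
  by rewrite in_partitions andbC; case: [forall _, _]; rewrite ?andbF ?andbT.
apply: ler_prod => i _; rewrite sumr_ge0/=; last by move=> *; rewrite exprn_ge0.
case: ifPn => iA.
  under eq_bigl do rewrite implybT.
  under eq_bigr do rewrite mulnC exprM.
  apply: geom_sum_le; first by rewrite exprn_ge0.
  by rewrite exprn_ilt1//; move: iA; rewrite in_setE => /Apos; rewrite /positives/= => /lt0n_neq0.
under eq_bigl do rewrite implybF -leqNgt leqn0.
by rewrite (big_pred1 ord0) // mul0n expr0.
Qed.

(** Parts and multiplicities are capped at [L], so the weight is at most [L.+1 * (L * L)]. Grouping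
    the expanded product by weight, the group of weight [m] injects into the partitions of [m]. *)
Lemma pA_gf_lower_fin (R : realType) (A : set nat) (x : R) (L : nat) :
  A `<=` positives -> 0 <= x -> x < 1 ->
  \prod_(1 <= a < L.+1 | a \in A) ((1 - x ^+ (a * L.+1)) / (1 - x ^+ a)) <=
  \sum_(m < (L.+1 * (L * L)).+1) (pA A m)%:R * x ^+ m.
Proof.
move=> Apos x0 x1; rewrite prod_pos_ord //.
have -> : \prod_(i < L.+1) (if (i : nat) \in A then (1 - x ^+ (i * L.+1)) / (1 - x ^+ i)
      else 1) = \prod_(i < L.+1)
   (\sum_(j < L.+1 | ((0 < j)%N ==> ((i : nat) \in A))) x ^+ (j * i)).
  apply: eq_bigr => i _; case: ifPn => iA.
    under [RHS]eq_bigl do rewrite implybT.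
    under [RHS]eq_bigr do rewrite mulnC exprM.
    rewrite geom_sum ?exprM// lt_eqF// exprn_ilt1//.
    by move: iA; rewrite in_setE => /Apos; rewrite /positives/= => /lt0n_neq0.
  under eq_bigl do rewrite implybF -leqNgt leqn0.
  by rewrite (big_pred1 ord0) // mul0n expr0.
rewrite prod_sum_weight.
pose w (f : {ffun 'I_L.+1 -> 'I_L.+1}) := (\sum_(i < L.+1) f i * i)%N.
have wle f : (w f < (L.+1 * (L * L)).+1)%N.
  rewrite ltnS /w; apply: (@leq_trans (\sum_(i < L.+1) (L * L))%N).
    by apply: leq_sum => i _; rewrite leq_mul// -ltnS.
  by rewrite sum_nat_const card_ord.
rewrite (partition_big (fun f => Ordinal (wle f)) xpredT) //=.
apply: ler_sum => m _.
rewrite (eq_bigr (fun=> x ^+ m)); last by move=> f /andP[_ /eqP <-].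
rewrite sumr_const -[leLHS]mulr_natl ler_wpM2r ?exprn_ge0// ler_nat.
pose S := [set f : {ffun 'I_L.+1 -> 'I_L.+1} |
   [forall i : 'I_L.+1, (0 < f i)%N ==> ((i : nat) \in A)] && (Ordinal (wle f) == m)]%SET.
rewrite (_ : #|_| = #|S|)%N; last by apply: eq_card => f; rewrite /S inE.
pose ext (f : {ffun 'I_L.+1 -> 'I_L.+1}) i :=
  (if insub i is Some j then f j : nat else 0)%N.
have extE f (i : 'I_L.+1) : ext f i = f i by rewrite /ext valK.
have ext0 f i : (L < i)%N -> ext f i = 0%N.
  by move=> ni; rewrite /ext insubF// ltnNge; apply/negbTE; rewrite negbK.
apply: (@card_le_pA _ _ ext _ L.+1) => //.
- move=> f i; rewrite /S inE => /andP[/forallP fA _].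
  have [iL|Li] := ltnP i L.+1; last by rewrite ext0.
  by rewrite (extE f (Ordinal iL)) => /(implyP (fA (Ordinal iL))).
- by move=> f i _; exact: ext0.
- move=> f; rewrite /S inE => /andP[_ /eqP/(congr1 val) /= <-].
  by rewrite /w; apply: eq_bigr => i _; rewrite extE.
move=> f g _ _ fg; apply/ffunP => i; apply/val_inj => /=.
by have := fg i; rewrite !extE.
Qed.

(** Passing to the limit in [L] here lets finite sums and products stand in for infinite ones. *)
Lemma le_of_geometric_error (R : realType) (x P B c : R) (K : nat) :
  0 <= x -> x < 1 -> (forall L, (K <= L)%N -> P <= B + c * x ^+ L) -> P <= B.
Proof.
move=> x0 x1 H; rewrite leNgt; apply/negP => BP.
have : (fun L => c * x ^+ L) @ \oo --> (0 : R).
  rewrite -(mulr0 c); apply: cvgMr; apply: cvg_expr.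
  by rewrite ger0_norm.
move/cvgrPdist_lt => /(_ (P - B)); rewrite subr_gt0 => /(_ BP) [N _ HN].
have := HN (maxn N K); rewrite /= leq_maxl => /(_ isT).
have := H (maxn N K) (leq_maxr _ _).
rewrite sub0r normrN => H1 H2; have := le_lt_trans (ler_norm _) H2; lra.
Qed.

(** The mean value theorem as a monotonicity test, used for the logarithm, sine and entropy
    inequalities. *)
Lemma le_of_derive_ge0 (R : realType) (f df : R -> R) (a b : R) : a <= b ->
  (forall x, a <= x <= b -> is_derive x 1 f (df x)) ->
  (forall x, a < x < b -> 0 <= df x) -> f a <= f b.
Proof.
move=> ab fd df0.
have [ab'|] := ltP a b; last first.
  by move=> ba; rewrite (@le_anti _ _ a b) // ab ba.
have fc : {within `[a, b], continuous f}.
  apply: derivable_within_continuous => x; rewrite in_itv /= => xab.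
  by have [] := fd x xab.
have [| c cab E] := @MVT R f df a b ab' _ fc.
  move=> x; rewrite in_itv /= => /andP[ax xb]; apply: fd.
  by rewrite !ltW.
rewrite -subr_ge0 E mulr_ge0 ?subr_ge0//; apply: df0.
by move: cab; rewrite in_itv.
Qed.

Lemma is_derive_ln1B (R : realType) (x : R) : x < 1 ->
  is_derive x 1 (fun y => - ln (1 - y)) (1 - x)^-1.
Proof.
move=> x1.
have dB : is_derive x 1 (fun y : R => 1 - y) (-1).
  by apply: is_derive_eq; rewrite add0r mul1r.
have x1' : 0 < 1 - x by rewrite subr_gt0.
have := @is_derive1_comp R (@ln R) (fun y => 1 - y) x (1 - x)^-1 (-1)
  (is_derive1_ln x1') dB.
by move/is_deriveN; rewrite mulrN1 opprK.
Qed.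

Lemma is_derive_ln_series (R : realType) (J : nat) (x : R) :
  is_derive x 1 (fun y : R => \sum_(j < J) y ^+ j.+1 / j.+1%:R) (\sum_(j < J) x ^+ j).
Proof.
elim: J => [|J IH].
  rewrite big_ord0 (_ : (fun _ => _) = cst 0); first exact: is_derive_cst.
  by apply/funext => y; rewrite big_ord0.
rewrite big_ord_recr /= (_ : (fun _ => _) =
    (fun y : R => \sum_(j < J) y ^+ j.+1 / j.+1%:R) + (fun y => y ^+ J.+1 / J.+1%:R)).
  apply: is_deriveD.
  have -> : (fun y : R => y ^+ J.+1 / J.+1%:R) = J.+1%:R^-1 \*: ((@id R) ^+ J.+1).
    by apply/funext => y; rewrite /= exprfctE /GRing.scale /= mulrC.
  apply: is_derive_eq.
  by rewrite /GRing.scale /= mulr1 mulrA mulVf ?mul1r// pnatr_eq0.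
by apply/funext => y; rewrite big_ord_recr.
Qed.

Lemma ln1B_ge_series (R : realType) (J : nat) (y : R) : 0 <= y -> y < 1 ->
  \sum_(j < J) y ^+ j.+1 / j.+1%:R <= - ln (1 - y).
Proof.
move=> y0 y1.
pose f (x : R) := - ln (1 - x) - \sum_(j < J) x ^+ j.+1 / j.+1%:R.
suff : f 0 <= f y.
  rewrite /f subr0 ln1 oppr0 sub0r big1 ?oppr0 ?subr_ge0// => i _.
  by rewrite expr0n mul0r.
apply: (@le_of_derive_ge0 R f (fun x => (1 - x)^-1 - \sum_(j < J) x ^+ j) 0 y) => //.
  move=> x /andP[x0 xy]; apply: is_deriveB.
    by apply: is_derive_ln1B; exact: le_lt_trans y1.
  exact: is_derive_ln_series.
move=> x /andP[x0 xy]; rewrite subr_ge0 geom_sum_le// ?ltW//.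
exact: lt_trans y1.
Qed.

(** The remainder has derivative [x ^+ J / (1 - x)], increasing in [x], hence at most its value [C]
    at [y]. *)
Lemma ln1B_le_series (R : realType) (J : nat) (y : R) : 0 <= y -> y < 1 ->
  - ln (1 - y) <= \sum_(j < J) y ^+ j.+1 / j.+1%:R + y ^+ J / (1 - y) * y.
Proof.
move=> y0 y1.
pose C := y ^+ J / (1 - y).
pose f (x : R) := C * x - (- ln (1 - x) - \sum_(j < J) x ^+ j.+1 / j.+1%:R).
suff : f 0 <= f y.
  rewrite /f subr0 ln1 oppr0 sub0r mulr0 big1 ?oppr0 ?subr0; last first.
    by move=> i _; rewrite expr0n mul0r.
  by rewrite -/C; lra.
apply: (@le_of_derive_ge0 R f (fun x => C - ((1 - x)^-1 - \sum_(j < J) x ^+ j)) 0 y) => //.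
  move=> x /andP[x0 xy]; apply: is_deriveB.
    by apply: is_derive_eq; rewrite /GRing.scale/= mulr1.
  apply: is_deriveB.
    by apply: is_derive_ln1B; exact: le_lt_trans y1.
  exact: is_derive_ln_series.
move=> x /andP[x0 xy]; have x1 : x < 1 by exact: lt_trans y1.
rewrite geom_sum ?lt_eqF// subr_ge0 /C.
have -> : (1 - x)^-1 - (1 - x ^+ J) / (1 - x) = x ^+ J / (1 - x) by ring.
apply: ler_pM.
- by rewrite exprn_ge0 // ltW.
- by rewrite invr_ge0 subr_ge0 ltW.
- by apply: lerXn2r; rewrite ?nnegrE// ltW.
- by rewrite lef_pV2 ?posrE ?subr_gt0 // lerD2l lerN2 ltW.
Qed.

(** In [pA_gf_lower_fin] truncation costs each factor with [a <= K] at most a factor [1 - x ^+ L],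
    and the factors with [a > K] are at least 1. By Bernoulli's inequality the total loss is
    [O(x ^+ L)], which vanishes as [L] grows. *)
Lemma pA_gf_lower (R : realType) (A : set nat) (x B : R) (K : nat) :
  A `<=` positives -> 0 <= x -> x < 1 ->
  (forall M, \sum_(m < M) (pA A m)%:R * x ^+ m <= B) ->
  \prod_(1 <= a < K.+1 | a \in A) (1 - x ^+ a)^-1 <= B.
Proof.
move=> Apos x0 x1 HB.
set P := \prod_(_ <= _ < _ | _) _.
have Aa a : a \in A -> (0 < a)%N by rewrite in_setE => /Apos.
have x1a a : a \in A -> 0 < 1 - x ^+ a.
  by move=> /Aa a0; rewrite subr_gt0 exprn_ilt1// -lt0n.
have P0 : 0 <= P.
  by apply: prodr_ge0 => a /x1a a0; rewrite invr_ge0 ltW.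
apply: (@le_of_geometric_error R x P B (P * K%:R) K) => // L KL.
apply: (@le_trans _ _ (P * K%:R * x ^+ L + P * (1 - x ^+ L) ^+ K)).
  have : 1 - K%:R * x ^+ L <= (1 - x ^+ L) ^+ K.
    have xL0 : 0 <= x ^+ L by rewrite exprn_ge0.
    have xL1 : x ^+ L <= 1 by rewrite exprn_ile1// ltW.
    elim: (K) => [|k IH]; first by rewrite mul0r subr0 expr0.
    rewrite exprS; apply: le_trans (ler_wpM2l _ IH); last by lra.
    rewrite -natr1; have := ler0n R k; nra.
  move=> /(ler_wpM2l P0); lra.
rewrite addrC lerD2r.
apply: le_trans (HB (L.+1 * (L * L)).+1).
apply: le_trans (pA_gf_lower_fin _ _ _ L Apos x0 x1).
rewrite [leRHS](@big_cat_nat _ _ _ K.+1)//= big_split /=.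
rewrite -[leLHS]mulr1; apply: ler_pM => //.
- by rewrite mulr_ge0// exprn_ge0// subr_ge0 exprn_ile1// ltW.
- rewrite mulrC ler_wpM2r//.
  rewrite [leRHS]big_mkcond /=.
  rewrite (_ : (1 - x ^+ L) ^+ K = \prod_(1 <= a < K.+1) (1 - x ^+ L)); last first.
    by rewrite prodr_const_nat subn1.
  apply: ler_prod => a _; rewrite subr_ge0 exprn_ile1 ?(ltW x1)//=.
  case: ifPn => [/Aa a0|_]; last by rewrite gerBl exprn_ge0.
  rewrite lerD2l lerN2 ler_wiXn2l// ?ltW//.
  exact: leq_trans (leqnSn L) (leq_pmull _ a0).
apply: (big_ind (fun z => 1 <= z)) => // [u v|a aA]; first exact: mulr_ege1.
rewrite ler_pdivlMr ?x1a// mul1r lerD2l lerN2 ler_wiXn2l ?(ltW x1)//.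
by rewrite leq_pmulr.
Qed.

(** * The Basel problem *)

Lemma sin_le_id (R : realType) (x : R) : 0 <= x -> sin x <= x.
Proof.
move=> x0; rewrite -subr_ge0.
pose f (y : R) := y - sin y.
suff : f 0 <= f x by rewrite /f sin0 subrr.
apply: (@le_of_derive_ge0 R f (fun y => 1 - cos y) 0 x) => //.

Qed.

(** Squared, this gives [1 / sin^2 x - 1 <= 1 / x^2], the lower half of the comparison in
    [odd_basel]. *)
Lemma mul_cos_le_sin (R : realType) (x : R) :
  0 <= x -> x <= pi / 2 -> x * cos x <= sin x.
Proof.
move=> x0 xpi; rewrite -subr_ge0.
pose f (y : R) := sin y - y * cos y.
suff : f 0 <= f x by rewrite /f sin0 mul0r subrr.
apply: (@le_of_derive_ge0 R f (fun y => y * sin y) 0 x) => // [y _|y /andP[y0 yx]].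
  by apply: is_derive_eq; rewrite /GRing.scale /=; ring.
rewrite mulr_ge0 ?ltW// sin_gt0_pihalf// y0 /=; exact: lt_le_trans xpi.
Qed.

(** With powers of two as denominators, doubling the [k]-th angle of level [n.+1] gives the [k]-th
    angle of level [n]. *)
Definition basel_angle (R : realType) (n k : nat) : R :=
  (k.*2.+1)%:R * pi / 2 ^+ n.+2.

Lemma basel_angle_gt0 (R : realType) (n k : nat) : 0 < basel_angle R n k.
Proof. by rewrite !mulr_gt0 ?invr_gt0 ?exprn_gt0 ?ltr0n ?pi_gt0. Qed.

Lemma basel_angle_lt (R : realType) (n k : nat) : (k < 2 ^ n)%N ->
  basel_angle R n k < pi / 2.
Proof.
move=> kn; rewrite /basel_angle ltr_pdivrMr ?exprn_gt0//.
rewrite (_ : pi / 2 * 2 ^+ n.+2 = (2 ^ n.+1)%:R * pi).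
  by rewrite ltr_pM2r ?pi_gt0// ltr_nat expnS mul2n -doubleS leq_double.
by rewrite natrX [in LHS]exprS; field.
Qed.

Lemma sin_basel_angle (R : realType) (n k : nat) : (k < 2 ^ n)%N ->
  0 < sin (basel_angle R n k).
Proof.
by move=> kn; rewrite sin_gt0_pihalf// basel_angle_gt0 basel_angle_lt.
Qed.

(* Induction by 4/sin^2(2a) = 1/sin^2(a) + 1/cos^2(a): the k-th and the
   k-th-from-last angles of the next level are complementary. *)
Lemma sum_csc2 (R : realType) (n : nat) :
  \sum_(k < 2 ^ n) (sin (basel_angle R n k)) ^- 2 = 2 * 4 ^+ n.
Proof.
elim: n => [|n IH].
  rewrite expn0 big_ord1 /basel_angle mul1r expr0 mulr1.
  have -> : pi / 2 ^+ 2 = pi / 4 :> R by congr (_ / _); rewrite -natrX.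
  have := cos2Dsin2 (pi / 4 : R).
  have : tan (pi / 4) = 1 :> R := tan_piquarter R.
  rewrite /tan => t1.
  have c0 : cos (pi / 4 : R) != 0.
    by apply: contra_eq_neq t1 => ->; rewrite invr0 mulr0 eq_sym oner_neq0.
  move/(congr1 ( *%R ^~ (cos (pi / 4)))): t1; rewrite divfK// mul1r => ->.
  move=> c2; have -> : cos (pi / 4 : R) ^+ 2 = 2^-1 by lra.
  by rewrite invrK.
rewrite exprS mulrCA -IH mulr_sumr expnS mul2n -addnn.
rewrite -(big_mkord xpredT (fun k => sin (basel_angle R n.+1 k) ^- 2)).
rewrite (big_cat_nat (leq0n _) (leq_addr (2 ^ n) (2 ^ n)%N)) /= big_mkord.
rewrite -[X in index_iota X (_ + _)]add0n big_addn addnK big_nat_rev /= big_mkord -big_split /=.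
apply: eq_bigr => k _.
have kn := ltn_ord k.
have -> : basel_angle R n.+1 (0 + 2 ^ n - k.+1 + 2 ^ n) = pi / 2 - basel_angle R n.+1 k.
  rewrite /basel_angle add0n.
  have -> : ((2 ^ n - k.+1 + 2 ^ n).*2.+1)%:R = 4 * 2 ^+ n - (k.*2.+1)%:R :> R.
    rewrite -!natrX -natrM -natrB; last by lia.
    by congr (_%:R); lia.
  by rewrite !exprS; field.
have -> : basel_angle R n k = basel_angle R n.+1 k *+ 2.
  by rewrite /basel_angle -mulr_natl [in RHS]exprS; field.
set a := basel_angle R n.+1 k.
have a0 : 0 < a by exact: basel_angle_gt0.
have api : a < pi / 2.
  by apply: basel_angle_lt; rewrite expnS mul2n -addnn ltn_addr.
have sa : sin a != 0 by rewrite gt_eqF// sin_gt0_pihalf// a0.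
have ca : cos a != 0.
  by rewrite gt_eqF// cos_gt0_pihalf// api andbT (lt_trans _ a0)// oppr_lt0 divr_gt0 ?pi_gt0.
rewrite sinB sin_pihalf cos_pihalf mul1r mul0r subr0 sin_mulr2n -mulr_natl.
rewrite [_ ^- 2 + _](_ : _ = (cos a ^+ 2 + sin a ^+ 2) / (cos a * sin a) ^+ 2);
  last by field; rewrite sa ca.
by rewrite cos2Dsin2; field; rewrite sa ca.
Qed.

(** For an angle [a] the value [1 / a^2] lies between [1 / sin^2 a - 1] and [1 / sin^2 a]. Over the
    [2 ^ n] angles of [sum_csc2] the error is at most [2 ^ n] against a total of [2 * 4 ^ n]. *)
Lemma odd_basel (R : realType) (n : nat) :
  let O := \sum_(k < 2 ^ n) ((k.*2.+1)%:R ^- 2 : R) in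
  O <= pi ^+ 2 / 8 /\ pi ^+ 2 / 8 - pi ^+ 2 / 16 / 2 ^+ n <= O.
Proof.
move=> O.
have pi0 : pi != 0 :> R by rewrite gt_eqF// pi_gt0.
have n0 : 2 ^+ n != 0 :> R by rewrite expf_neq0// pnatr_eq0.
have E : \sum_(k < 2 ^ n) (basel_angle R n k) ^- 2 = 16 * 4 ^+ n / pi ^+ 2 * O.
  rewrite /O mulr_sumr; apply: eq_bigr => k _; rewrite /basel_angle.
  have -> : 4 ^+ n = (2 ^+ n) ^+ 2 :> R
    by rewrite -exprM mulnC exprM; congr (_ ^+ _); rewrite -natrX.
  rewrite !exprS; move: (pi : R) pi0 => P P0; field.
  by rewrite nat1r pnatr_eq0 P0 n0.
have [U L] : \sum_(k < 2 ^ n) (basel_angle R n k) ^- 2 <= 2 * 4 ^+ n /\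
    2 * 4 ^+ n - 2 ^+ n <= \sum_(k < 2 ^ n) (basel_angle R n k) ^- 2.
  rewrite -sum_csc2; split.
    apply: ler_sum => k _; have s0 := sin_basel_angle R n k (ltn_ord k).
    have a0 := basel_angle_gt0 R n k.
    rewrite lef_pV2 ?posrE ?exprn_gt0//; apply: lerXn2r; rewrite ?nnegrE ?(ltW s0) ?(ltW a0)//.
    by apply: sin_le_id; exact: ltW.
  have -> : 2 ^+ n = \sum_(k < 2 ^ n) (1 : R).
    by rewrite sumr_const card_ord natrX.
  rewrite -sumrB; apply: ler_sum => k _; have s0 := sin_basel_angle R n k (ltn_ord k).
  have a0 := basel_angle_gt0 R n k; have ap := basel_angle_lt R n k (ltn_ord k).
  have := mul_cos_le_sin R _ (ltW a0) (ltW ap).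
  set a := basel_angle R n k in a0 ap s0 *.
  have c0 : 0 < cos a.
    by rewrite cos_gt0_pihalf// ap andbT (lt_trans _ a0)// oppr_lt0 divr_gt0 ?pi_gt0.
  move=> H; rewrite lerBlDr -(ler_pM2r (exprn_gt0 2 s0)) mulVf ?expf_neq0 ?gt_eqF//.
  rewrite mulrDl mul1r -lerBlDr -cos2sin2 mulrC ler_pdivlMr ?exprn_gt0//.
  rewrite -exprMn mulrC; apply: lerXn2r; rewrite ?nnegrE ?(ltW s0)//.
  by rewrite ltW// mulr_gt0.
have q0 : 0 < 4 ^+ n :> R by rewrite exprn_gt0.
have p0 : 0 < pi ^+ 2 :> R by rewrite exprn_gt0// pi_gt0.
have r0 : 0 < pi ^+ 2 / (16 * 4 ^+ n) :> R by apply: divr_gt0 => //; exact: mulr_gt0.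
rewrite E in U L; split.
  move: U; rewrite -(@ler_pM2l _ (pi ^+ 2 / (16 * 4 ^+ n))) //.
  rewrite (_ : _ * (_ * O) = O); last first.
    by move: (pi : R) pi0 => P P0; field; rewrite P0 gt_eqF.
  by rewrite (_ : _ * (2 * _) = pi ^+ 2 / 8); last by field; rewrite gt_eqF.
move: L; rewrite -(@ler_pM2l _ (pi ^+ 2 / (16 * 4 ^+ n))) //.
rewrite (_ : _ * (_ * O) = O); last first.
    by move: (pi : R) pi0 => P P0; field; rewrite P0 gt_eqF.
rewrite (_ : _ * (_ - _) = pi ^+ 2 / 8 - pi ^+ 2 / 16 / 2 ^+ n) //.
have -> : 4 ^+ n = (2 ^+ n) ^+ 2 :> R
    by rewrite -exprM mulnC exprM; congr (_ ^+ _); rewrite -natrX.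
by field.
Qed.

Definition zeta2 (R : realType) (J : nat) : R := \sum_(j < J) (j.+1%:R ^- 2).

Lemma zeta2_le (R : realType) (J K : nat) : (J <= K)%N -> zeta2 R J <= zeta2 R K.
Proof.
move=> JK; rewrite /zeta2 -!(big_mkord xpredT (fun j => (j.+1%:R : R) ^- 2)).
rewrite [leRHS](big_cat_nat (leq0n J) JK) /= lerDl sumr_ge0//.
Qed.

Lemma zeta2_double (R : realType) (m : nat) :
  zeta2 R m.*2 = \sum_(k < m) ((k.*2.+1)%:R ^- 2) + zeta2 R m / 4.
Proof.
elim: m => [|m IH]; first by rewrite /zeta2 !big_ord0 mul0r addr0.
rewrite /zeta2 doubleS !big_ord_recr /= -/(zeta2 R _) IH mulrDl.
have -> : (m.*2.+2)%:R ^- 2 = m.+1%:R ^- 2 / 4 :> R.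
  have -> : (m.*2.+2)%:R = 2 * m.+1%:R :> R by rewrite -natrM; congr (_%:R); lia.
  by field; rewrite nat1r pnatr_eq0.
rewrite /zeta2; ring.
Qed.

(** For [m = 2 ^ J], separating odd and even terms gives [zeta2 m <= zeta2 (2m) <= pi^2/8 + zeta2 m
    / 4]. *)
Lemma zeta2_le_pi (R : realType) (J : nat) : zeta2 R J <= pi ^+ 2 / 6.
Proof.
apply: (le_trans (zeta2_le R J (2 ^ J) (ltnW (ltn_expl J (ltnSn 1))))).
have [U _] := odd_basel R J.
have := zeta2_le R (2 ^ J) (2 ^ J).*2; rewrite zeta2_double -addnn leq_addr => /(_ isT).
lra.
Qed.

Lemma zeta2_double_gap (R : realType) (m : nat) : (0 < m)%N ->
  zeta2 R m.*2 - zeta2 R m <= m%:R^-1.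
Proof.
move=> m0; rewrite /zeta2 -!(big_mkord xpredT (fun j => (j.+1%:R : R) ^- 2)).
have mm : (m <= m.*2)%N by rewrite -addnn leq_addr.
rewrite (big_cat_nat (leq0n m) mm) /= addrAC subrr add0r.
apply: (@le_trans _ _ (\sum_(m <= i < m.*2) m%:R ^- 2)); last first.
  rewrite big_const_nat iter_addr addr0 -addnn addnK -[_ *+ _]mulr_natr.
  by rewrite le_eqVlt; apply/orP; left; apply/eqP; field; rewrite pnatr_eq0 -lt0n.
rewrite !big_nat; apply: ler_sum => i /andP[mi _].
rewrite lef_pV2 ?posrE ?exprn_gt0 ?ltr0n//; apply: lerXn2r; rewrite ?nnegrE// ler_nat.
exact: leqW.
Qed.

Lemma zeta2_ge_pi (R : realType) (e : R) : 0 < e ->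
  exists J, pi ^+ 2 / 6 - e <= zeta2 R J.
Proof.
move=> e0.
(* Solving the odd-even recursion for [zeta2] leaves an error of [(pi^2/12 + 1/3) / 2^n], which is
   at most [c / 2^n]; then [2^n > n > c / e] suffices. *)
pose c : R := pi ^+ 2 / 12 + 1.
pose n := (Num.truncn (c / e)).+1.
exists (2 ^ n).*2.
have [_ L] := odd_basel R n.
have M := zeta2_double_gap R (2 ^ n) ltac:(by rewrite expn_gt0).
have D := zeta2_double R (2 ^ n).
have H : c / e <= 2 ^+ n.
  apply: (@le_trans _ _ n%:R); first by rewrite ltW// truncnS_gt.
  by rewrite -natrX ler_nat ltnW// ltn_expl.
have n0 : 0 < 2 ^+ n :> R by rewrite exprn_gt0.
have C : c / 2 ^+ n <= e by move: H; rewrite !ler_pdivrMr// mulrC.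
rewrite natrX in M.
have E : pi ^+ 2 / 16 / 2 ^+ n + (2 ^+ n)^-1 / 4 <= 3 / 4 * (c / 2 ^+ n).
  rewrite (_ : 3 / 4 * _ = pi ^+ 2 / 16 / 2 ^+ n + 3 / 4 * (2 ^+ n)^-1); last first.
    by rewrite /c; field; rewrite gt_eqF.
  have : 0 < (2 ^+ n)^-1 :> R by rewrite invr_gt0.
  by rewrite lerD2l; lra.
move: L M D C E.
set O := \sum_(k < _) _; set Z := zeta2 _ _; set Z2 := zeta2 _ _.
set q := c / _; set u := pi ^+ 2 / 16 / _; set v := (2 ^+ n)^-1.
lra.
Qed.

(** * Asymptotics of the partition function *)

(** Both halves come from [1 + v <= expR v], at [v = - u] and at [v = u]. *)
Lemma inv_1BexpRN_bounds (R : realType) (u : R) : 0 < u ->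
  u^-1 <= (1 - expR (- u))^-1 <= 1 + u^-1.
Proof.
move=> u0.
have e1 : 0 < 1 - expR (- u) by rewrite subr_gt0 expR_lt1 oppr_lt0.
apply/andP; split.
  rewrite lef_pV2 ?posrE// lerBlDr -lerBlDl; have := expR_ge1Dx (- u); lra.
have v0 : 0 < expR (- u) by exact: expR_gt0.
rewrite -[leLHS]mul1r ler_pdivrMr//.
have H : expR (- u) * (1 + u) <= 1.
  rewrite -[leRHS](expRxMexpNx_1 (- u)) opprK ler_pM2l//; exact: expR_ge1Dx.
rewrite (_ : (1 + u^-1) * (1 - expR (- u)) = (1 + u - expR (- u) * (1 + u)) / u); last first.
  by field; rewrite gt_eqF.
rewrite ler_pdivlMr//; lra.
Qed.

Lemma sum_expr_from1 (R : realType) (y : R) (n : nat) : y != 1 ->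
  \sum_(1 <= a < n.+1) y ^+ a = (y - y ^+ n.+1) / (1 - y).
Proof.
move=> y1; rewrite big_add1 /= big_mkord.
under eq_bigr do rewrite exprS.
rewrite -mulr_sumr geom_sum// mulrA; congr (_ / _); rewrite exprS; ring.
Qed.

Lemma prod_inv1B_expR (R : realType) (x : R) (r : seq nat) (P : pred nat) :
  (forall a, P a -> 0 < 1 - x ^+ a) ->
  \prod_(a <- r | P a) (1 - x ^+ a)^-1 = expR (\sum_(a <- r | P a) - ln (1 - x ^+ a)).
Proof.
move=> H; rewrite expR_sum; apply: eq_bigr => a /H a0.
by rewrite expRN lnK.
Qed.

Lemma expRNX (R : realType) (t : R) (n : nat) : expR (- t) ^+ n = expR (- (t * n%:R)).
Proof. by rewrite -expRM_natr mulNr. Qed.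

Lemma positives_in (a : nat) : (a \in positives) = (0 < a)%N.
Proof. by apply/idP/idP; rewrite in_setE. Qed.

Lemma prod_positives (R : realType) (n : nat) (F : nat -> R) :
  \prod_(1 <= a < n.+1 | a \in positives) F a = \prod_(1 <= a < n.+1) F a.
Proof.
rewrite big_nat_cond [RHS]big_nat_cond; apply: eq_bigl => a.
by rewrite positives_in; case: ltnP; rewrite ?andbF ?andbT.
Qed.

(** Expanding the logarithm and summing over [a] first, the [j]-th term is at most [y / (1 - y) / j]
    with [y = expR (- t * j)], hence at most [1 / (t * j^2)]. The tail of the logarithm series is
    geometric in [J] for fixed [n] and is removed in the limit. *)
Lemma sum_ln1B_upper (R : realType) (t : R) (n : nat) : 0 < t ->
  \sum_(1 <= a < n.+1) - ln (1 - expR (- t) ^+ a) <= pi ^+ 2 / 6 / t.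
Proof.
move=> t0; set x := expR (- t).
have x0 : 0 < x by exact: expR_gt0.
have x1 : x < 1 by rewrite expR_lt1 oppr_lt0.
apply: (@le_of_geometric_error R x _ _ (n%:R / (1 - x)) 0) => [|//|J _]; first exact: ltW.
apply: (@le_trans _ _ (\sum_(1 <= a < n.+1)
    (\sum_(j < J) (x ^+ a) ^+ j.+1 / j.+1%:R + x ^+ J / (1 - x)))).
  rewrite !big_nat; apply: ler_sum => a /andP[a0 _].
  have xa : x ^+ a <= x by rewrite -[leRHS]expr1 ler_wiXn2l ?ltW.
  have xa1 : x ^+ a < 1 by exact: le_lt_trans x1.
  have xa0 : 0 < x ^+ a by rewrite exprn_gt0.
  apply: le_trans (ln1B_le_series R J _ (ltW xa0) xa1) _.
  rewrite lerD2l -[leRHS]mulr1; apply: ler_pM.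
  - by rewrite divr_ge0 ?exprn_ge0 ?subr_ge0// ltW.
  - exact: ltW.
  - apply: ler_pM; first by rewrite exprn_ge0// ltW.
    + by rewrite invr_ge0 subr_ge0 ltW.
    + by apply: lerXn2r; rewrite ?nnegrE// ltW.
    + by rewrite lef_pV2 ?posrE ?subr_gt0// lerD2l lerN2.
  - exact: ltW.
rewrite big_split /= sumr_const_nat subn1 /= -[_ *+ n]mulr_natl.
rewrite (_ : n%:R * (x ^+ J / (1 - x)) = n%:R / (1 - x) * x ^+ J); last by ring.
rewrite lerD2r exchange_big /=.
apply: (@le_trans _ _ (zeta2 R J / t)); last by rewrite ler_pM2r ?invr_gt0// zeta2_le_pi.
rewrite /zeta2 mulr_suml; apply: ler_sum => j _.
rewrite -mulr_suml.
under eq_bigr do rewrite -exprM mulnC exprM.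
have tj0 : 0 < t * j.+1%:R by rewrite mulr_gt0// ltr0n.
rewrite /x expRNX; set y := expR _.
have y0 : 0 < y by exact: expR_gt0.
have y1 : y < 1 by rewrite expR_lt1 oppr_lt0.
rewrite sum_expr_from1 ?lt_eqF//.
rewrite (_ : j.+1%:R ^- 2 / t = (t * j.+1%:R)^-1 / j.+1%:R); last first.
  by have := pnatr_eq0 R j.+1; move: j.+1%:R => w w0; field; rewrite w0 /= gt_eqF.
rewrite ler_pM2r ?invr_gt0 ?ltr0n//.
apply: (@le_trans _ _ (y / (1 - y))).
  by rewrite ler_pM2r ?invr_gt0 ?subr_gt0// gerBl exprn_ge0// ltW.
have /andP[_] := inv_1BexpRN_bounds R _ tj0; rewrite -/y.
rewrite (_ : y / (1 - y) = (1 - y)^-1 - 1); last by field; rewrite subr_eq0 gt_eqF.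
by rewrite lerBlDl.
Qed.

Lemma p_le_expR (R : realType) (t : R) (n : nat) : 0 < t ->
  (p n)%:R <= expR (t * n%:R + pi ^+ 2 / 6 / t).
Proof.
move=> t0; set x := expR (- t).
have x0 : 0 < x by exact: expR_gt0.
have x1 : x < 1 by rewrite expR_lt1 oppr_lt0.
have := pA_gf_upper R positives x n (fun _ h => h) (ltW x0) x1.
rewrite prod_positives big_nat_cond prod_inv1B_expR -?big_nat_cond; last first.
  by move=> a /andP[/andP[a0 _] _]; rewrite subr_gt0 exprn_ilt1 -?lt0n// ltW.
move=> /le_trans/(_ (_ : _ <= expR (pi ^+ 2 / 6 / t))).
rewrite ler_expR => /(_ (sum_ln1B_upper R t n t0)).
by rewrite /x expRNX expRN ler_pdivrMr ?expR_gt0// -expRD addrC.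
Qed.

(** The double sum of [sum_ln1B_upper] is now cut at [J] powers and bounded below:
    [y / (1 - y) >= 1 / (t * j) - 1], so the loss is at most 1 for each [j]. *)
Lemma gf_p_lower (R : realType) (t B : R) (J : nat) : 0 < t ->
  (forall M, \sum_(m < M) (p m)%:R * expR (- t) ^+ m <= B) ->
  expR (zeta2 R J / t - J%:R) <= B.
Proof.
move=> t0 HB; set x := expR (- t) in HB *.
have x0 : 0 < x by exact: expR_gt0.
have x1 : x < 1 by rewrite expR_lt1 oppr_lt0.
have xa1 a : (0 < a)%N -> x ^+ a < 1 by move=> a0; rewrite exprn_ilt1 -?lt0n// ltW.
have PB K := pA_gf_lower R positives x B K (fun _ h => h) (ltW x0) x1 HB.
have B0 : 0 < B.
  by have := PB 0%N; rewrite big_geq// => /(lt_le_trans ltr01).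
suff : zeta2 R J / t - J%:R <= ln B.
  by move=> H; rewrite -[leRHS](lnK B0) ler_expR.
pose y (j : nat) := x ^+ j.+1.
have y0 j : 0 < y j by rewrite exprn_gt0.
have y1 j : y j < 1 by rewrite xa1.
have yE j : y j = expR (- (t * j.+1%:R)) by rewrite /y /x expRNX.
apply: (@le_trans _ _ (\sum_(j < J) (y j / (1 - y j) / j.+1%:R))).
  rewrite -[X in _ - X%:R]card_ord -[X in _ - X%:R]muln1 -sum_nat_const natr_sum.
  rewrite /zeta2 mulr_suml -sumrB; apply: ler_sum => j _.
  have tj0 : 0 < t * j.+1%:R by rewrite mulr_gt0// ltr0n.
  have /andP[+ _] := inv_1BexpRN_bounds R _ tj0; rewrite -yE.
  rewrite (_ : y j / (1 - y j) = (1 - y j)^-1 - 1); last by field; rewrite subr_eq0 gt_eqF.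
  rewrite (_ : j.+1%:R ^- 2 / t = (t * j.+1%:R)^-1 / j.+1%:R); last first.
    by have := pnatr_eq0 R j.+1; move: j.+1%:R => w w0; field; rewrite w0 /= gt_eqF.
  have j0 : 0 < j.+1%:R^-1 :> R by rewrite invr_gt0.
  have j1 : j.+1%:R^-1 <= 1 :> R by rewrite invf_le1// ler1n.
  move=> /(ler_wpM2r (ltW j0)) H; rewrite [leRHS]mulrBl mul1r; exact: lerB.
(* Only parts up to [K] are summed; the missing tails of the geometric series are [O(x ^+ K)]. *)
apply: (@le_of_geometric_error R x _ _
   (\sum_(j < J) ((1 - y j)^-1 / j.+1%:R)) 0) => [|//|K _]; first exact: ltW.
have := PB K; rewrite prod_positives big_nat_cond prod_inv1B_expR -?big_nat_cond; last first.
  by move=> a /andP[/andP[a0 _] _]; rewrite subr_gt0 xa1.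
rewrite -[X in _ <= X](lnK B0) ler_expR => H.
apply: le_trans (lerD H (lexx _)); rewrite {H}.
apply: (@le_trans _ _ (\sum_(1 <= a < K.+1) (\sum_(j < J) (x ^+ a) ^+ j.+1 / j.+1%:R) +
   (\sum_(j < J) (1 - y j)^-1 / j.+1%:R) * x ^+ K)); last first.
  rewrite lerD2r !big_nat; apply: ler_sum => a /andP[a0 _].
  by apply: ln1B_ge_series; rewrite ?exprn_ge0 ?xa1// ltW.
rewrite exchange_big /= mulr_suml -big_split /=; apply: ler_sum => j _.
rewrite -mulr_suml.
under eq_bigr do rewrite -exprM mulnC exprM -/(y j).
rewrite sum_expr_from1 ?lt_eqF//.
rewrite [leRHS](_ : _ = (y j / (1 - y j) / j.+1%:R) +
   ((1 - y j)^-1 / j.+1%:R) * (x ^+ K - y j ^+ K.+1)); last by ring.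
rewrite lerDl mulr_ge0//; first by rewrite divr_ge0// invr_ge0 subr_ge0 ltW.
rewrite subr_ge0 /y -exprM ler_wiXn2l ?(ltW x0) ?(ltW x1)//.
by rewrite mulSn addSn (leq_trans (leqnSn K))// ltnS leq_addr.
Qed.

(** The square root of [zeta(2) = pi^2 / 6]; the constant of the theorem is [ln 2 / sqrt_zeta2]. *)
Definition sqrt_zeta2 (R : realType) : R := pi / Num.sqrt 6.

Lemma sqrt_zeta2_gt0 (R : realType) : 0 < sqrt_zeta2 R.
Proof. by rewrite divr_gt0 ?pi_gt0// sqrtr_gt0. Qed.

Lemma sqrt_zeta2_sqr (R : realType) : sqrt_zeta2 R ^+ 2 = pi ^+ 2 / 6.
Proof. by rewrite /sqrt_zeta2 exprMn exprVn sqr_sqrtr. Qed.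

(** The choice [t = sqrt_zeta2 / sqrt n] minimises the exponent of [p_le_expR]; [n = 0], where this
    [t] is meaningless, is separate. *)
Lemma p_le_expR_sqrt (R : realType) (n : nat) :
  (p n)%:R <= expR (2 * sqrt_zeta2 R * Num.sqrt n%:R).
Proof.
have s0 := sqrt_zeta2_gt0 R.
case: n => [|n].
  rewrite sqrtr0 mulr0 expR0 (ler_nat _ _ 1).
  by apply: leq_trans (max_card _) _; rewrite card_ffun !card_ord.
have r0 : 0 < Num.sqrt n.+1%:R :> R by rewrite sqrtr_gt0.
have := p_le_expR R (sqrt_zeta2 R / Num.sqrt n.+1%:R) n.+1 (divr_gt0 s0 r0).
rewrite -sqrt_zeta2_sqr -[X in _ * X + _](@sqr_sqrtr _ n.+1%:R)//.
set r := Num.sqrt _ in r0 *; set s := sqrt_zeta2 R in s0 *.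
rewrite (_ : s / r * r ^+ 2 + s ^+ 2 / (s / r) = 2 * s * r)//.
by field; rewrite !gt_eqF.
Qed.

Lemma lin_le_expR_root4 (R : realType) (a b c : R) : 0 < c ->
  \forall n \near \oo, a + b * n%:R <= expR (c * Num.sqrt (Num.sqrt n%:R)).
Proof.
move=> c0.
(* The term of order 8 of the exponential series at [c * n^(1/4)] is [d * n^2], which outgrows any
   linear function. *)
pose d := c ^+ 8 / 8`!%:R.
have d0 : 0 < d by rewrite divr_gt0 ?exprn_gt0// ltr0n fact_gt0.
near=> n.
have n1 : 1 <= n%:R :> R by rewrite ler1n; near: n; exists 1%N.
have nd : (`|a| + `|b|) / d <= n%:R.
  apply: (@le_trans _ _ (Num.truncn ((`|a| + `|b|) / d)).+1%:R).
    by rewrite ltW// truncnS_gt.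
  by rewrite ler_nat; near: n; exists (Num.truncn ((`|a| + `|b|) / d)).+1.
have r0 : 0 <= Num.sqrt (Num.sqrt n%:R) :> R by rewrite sqrtr_ge0.
have := expR_ge1Dxn 7 (mulr_ge0 (ltW c0) r0).
rewrite exprMn (_ : Num.sqrt _ ^+ 8 = n%:R ^+ 2 :> R); last first.
  by rewrite (exprM _ 2 4) (exprM _ 2 2) !sqr_sqrtr// sqrtr_ge0.
rewrite mulrAC -/d => H; apply: le_trans H.
apply: (@le_trans _ _ (d * n%:R ^+ 2)); last by rewrite lerDr.
move: nd; rewrite ler_pdivrMr// => nd.
have A := ler_norm a; have B := ler_norm b.
have Aa := normr_ge0 a; have Bb := normr_ge0 b.
apply: (@le_trans _ _ (`|a| * n%:R + `|b| * n%:R)).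
  by apply: lerD; nra.
by rewrite expr2 mulrA -mulrDl mulrC [leRHS]mulrC ler_pM2l ?(lt_le_trans ltr01)// mulrC.
Unshelve. all: by end_near. Qed.

Lemma lin_le_expR_sqrt (R : realType) (a b c : R) : 0 < c ->
  \forall n \near \oo, a + b * n%:R <= expR (c * Num.sqrt n%:R).
Proof.
move=> c0; near=> n.
have n1 : 1 <= Num.sqrt n%:R :> R.
  by rewrite -[leLHS]sqrtr1 ler_wsqrtr// ler1n; near: n; exists 1%N.
apply: (@le_trans _ _ (expR (c * Num.sqrt (Num.sqrt n%:R)))).
  by near: n; exact: lin_le_expR_root4.
rewrite ler_expR ler_pM2l// -[leRHS]sqr_sqrtr ?(le_trans ler01 n1)// expr2.
by rewrite ler_peMl ?sqrtr_ge0// -[leLHS]sqrtr1 ler_wsqrtr.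
Unshelve. all: by end_near. Qed.

(* Completing the square, 2 s sqrt m - t m = s y - t (sqrt m - y)^2: outside the window
   (1 - d) y <= sqrt m, m <= n, the square is at least k (m + y^2). *)
Lemma p_gf_term_le (R : realType) (d y : R) (n m : nat) :
  let s := sqrt_zeta2 R in let k := d ^+ 2 / 8 in let t := s / y in
  0 < d -> d < 1 -> 0 < y -> Num.sqrt n%:R = (1 + d) * y ->
  (p m)%:R * expR (- t) ^+ m <= expR (s * y * (1 - k)) * expR (- (t * k)) ^+ m +
    if (m <= n)%N then (p n)%:R * expR (- ((1 - d) ^+ 2 * (s * y))) else 0.
Proof.
move=> s k t d0 d1 y0 ny.
have s0 : 0 < s by exact: sqrt_zeta2_gt0.
have t0 : 0 < t by rewrite divr_gt0.
have tyy : t * y ^+ 2 = s * y by rewrite /t; field; rewrite gt_eqF.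
set r := Num.sqrt (m%:R : R).
have r0 : 0 <= r by rewrite sqrtr_ge0.
have mr : m%:R = r ^+ 2 by rewrite sqr_sqrtr.
(* Inside the window [p m <= p n] by monotonicity and [t * m >= (1 - d)^2 * s * y]. *)
have [/andP[ydr mn]|H] := boolP (((1 - d) * y <= r) && (m <= n)%N).
  rewrite mn -[leLHS]add0r; apply: lerD.
    by rewrite mulr_ge0// ?exprn_ge0 ?expR_ge0.
  apply: ler_pM => //; rewrite ?exprn_ge0 ?expR_ge0 ?ler_nat ?leq_p//.
  rewrite expRNX ler_expR lerN2 mr -tyy mulrCA ler_pM2l//.
  rewrite -exprMn; apply: lerXn2r; rewrite ?nnegrE// mulr_ge0 ?ltW// subr_gt0//.
rewrite -[leLHS]addr0; apply: lerD; last first.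
  by case: ifP => // _; rewrite mulr_ge0// expR_ge0.
apply: (@le_trans _ _ (expR (2 * s * r) * expR (- t) ^+ m)).
  by rewrite ler_wpM2r ?exprn_ge0 ?expR_ge0// p_le_expR_sqrt.
rewrite !expRNX -!expRD ler_expR mr.
have -> : 2 * s * r - t * r ^+ 2 = s * y - t * (r - y) ^+ 2.
  by rewrite -tyy /t; field; rewrite gt_eqF.
suff : k * (r ^+ 2 + y ^+ 2) <= (r - y) ^+ 2.
  move=> /(ler_wpM2l (ltW t0)); rewrite -subr_ge0 => H1.
  rewrite -tyy -subr_ge0; apply: le_trans H1 _.
  by rewrite le_eqVlt; apply/orP; left; apply/eqP; ring.
have k8 : k * 8 = d ^+ 2 by rewrite /k; field.
have dd0 : 0 <= d ^+ 2 by rewrite exprn_ge0// ltW.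
rewrite -(ler_pM2r (ltr0n R 8)) mulrAC k8.
(* Below the window [y - r >= d * y] and [r <= y], so the square is at least
   [d^2 (r^2 + y^2) / 2]. *)
have [ry|ry] := ltP r ((1 - d) * y).
  have h1 : d * y <= y - r by lra.
  have h2 : (d * y) ^+ 2 <= (y - r) ^+ 2.
    have h0 : 0 <= d * y by rewrite mulr_ge0 ?ltW.
    by apply: lerXn2r; rewrite ?nnegrE ?(le_trans h0).
  have h3 : r ^+ 2 <= y ^+ 2.
    apply: lerXn2r; rewrite ?nnegrE ?(ltW y0)// ltW// (lt_le_trans ry)//.
    by rewrite mulrBl mul1r gerBl mulr_ge0// ltW.
  have h4 := ler_wpM2l dd0 h3.
  rewrite exprMn in h2; rewrite -[(r - y) ^+ 2]sqrrN opprB mulrDr; have := sqr_ge0 (y - r); lra.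
have {}ry : (1 + d) * y <= r.
  move: H; rewrite ry /= -ltnNge -ny => nm.
  by apply: ler_wsqrtr; rewrite ler_nat ltnW.
(* Above the window this bound, from [d < 1], gives a square of at least
   [d^2 r^2 / 4 >= d^2 (r^2 + y^2) / 8], hence the 8 in [k]. *)
have h1 : d * r <= 2 * (r - y).
  have : 0 <= (1 - d) * (r - (1 + d) * y) by rewrite mulr_ge0 ?subr_ge0// ltW.
  have : 0 <= d * y * (1 - d) by rewrite !mulr_ge0 ?subr_ge0 ?ltW.
  nra.
have h2 : (d * r) ^+ 2 <= (2 * (r - y)) ^+ 2.
  have h0 : 0 <= d * r by rewrite mulr_ge0// ltW.
  by apply: lerXn2r; rewrite ?nnegrE ?(le_trans h0).
have h3 : y ^+ 2 <= r ^+ 2.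
  apply: lerXn2r; rewrite ?nnegrE ?(ltW y0)//.
  by apply: le_trans ry; rewrite ler_peMl ?(ltW y0)// lerDl ltW.
have h4 := ler_wpM2l dd0 h3.
rewrite !exprMn in h2; rewrite mulrDr; lra.
Qed.

(** The first summands of [p_gf_term_le] form a geometric series of ratio [expR (- (t * k))]; the
    second ones occur for at most [n.+1] indices, whatever [M] is. *)
Lemma p_gf_sum_le (R : realType) (d y : R) (n M : nat) :
  let s := sqrt_zeta2 R in let k := d ^+ 2 / 8 in let t := s / y in
  0 < d -> d < 1 -> 0 < y -> Num.sqrt n%:R = (1 + d) * y ->
  \sum_(m < M) (p m)%:R * expR (- t) ^+ m <=
    expR (s * y * (1 - k)) * (1 + (t * k)^-1) +
    n.+1%:R * (p n)%:R * expR (- ((1 - d) ^+ 2 * (s * y))).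
Proof.
move=> s k t d0 d1 y0 ny.
have s0 : 0 < s by exact: sqrt_zeta2_gt0.
have k0 : 0 < k by apply: divr_gt0 => //; exact: exprn_gt0.
have tk0 : 0 < t * k by apply: mulr_gt0 => //; exact: divr_gt0.
apply: (le_trans (ler_sum _ (fun (m : 'I_M) _ =>
  p_gf_term_le R d y n m d0 d1 y0 ny))).
rewrite big_split /= -mulr_sumr; apply: lerD.
  rewrite ler_pM2l ?expR_gt0//.
  apply: le_trans (geom_sum_le _ _ _ (expR_ge0 _) _) _.
    by rewrite expR_lt1 oppr_lt0.
  by have /andP[] := inv_1BexpRN_bounds R _ tk0.
set C := (p n)%:R * _; rewrite -mulrA -/C.
have C0 : 0 <= C by rewrite mulr_ge0 ?expR_ge0.
rewrite -big_mkcond /= sumr_const -[leLHS]mulr_natl ler_wpM2r// ler_nat.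
have inj : {in [pred m : 'I_M | (m <= n)%N] &, injective (fun m : 'I_M => inord m : 'I_n.+1)}.
  by move=> i j; rewrite !inE => im jm /(congr1 val); rewrite /= !inordK// => /val_inj.
apply: leq_trans (_ : #|[pred m : 'I_M | (m <= n)%N]| <= _)%N; first by [].
by rewrite -(card_in_image inj) (leq_trans (max_card _))// card_ord.
Qed.

(** The Tauberian step: [gf_p_lower] makes the generating function larger than the terms outside the
    window of [p_gf_sum_le] can account for, so [n.+1 * p n] must supply the rest. *)
Lemma p_eventually_ge (R : realType) (l : R) : 0 <= l -> l < 2 * sqrt_zeta2 R ->
  \forall n \near \oo, expR (l * Num.sqrt n%:R) <= (p n)%:R :> R.
Proof.
move=> l0; have := sqrt_zeta2_gt0 R; move sE : (sqrt_zeta2 R) => s s0 ls.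
(* Thus [l = 2 * s - 10 * s * d], low enough to stay below the exponent [g], which is [2 * s - O(d)]
   with a smaller constant. *)
pose d := (2 * s - l) / (10 * s).
have d0 : 0 < d by apply: divr_gt0; [rewrite subr_gt0|exact: mulr_gt0].
have d15 : d <= 1 / 5 by rewrite /d ler_pdivrMr ?mulr_gt0//; lra.
have d1 : d < 1 by lra.
have dl : l = 2 * s - 10 * s * d by rewrite /d; field; rewrite gt_eqF.
pose k := d ^+ 2 / 8.
have k0 : 0 < k by apply: divr_gt0 => //; exact: exprn_gt0.
have k8 : k * 8 = d ^+ 2 by rewrite /k; field.
have d10 : 0 < 1 + d by lra.
have [J zJ] : exists J, s ^+ 2 * (1 - k / 2) <= zeta2 R J.
  have [|J] := @zeta2_ge_pi R (s ^+ 2 * (k / 2)).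
    by rewrite mulr_gt0 ?exprn_gt0// divr_gt0.
  by rewrite -sE sqrt_zeta2_sqr => H; exists J; apply: le_trans H; lra.
(* The exponent finally obtained: [g * sqrt n] is [s * y * (1 - k / 2)] from the generating function
   plus [(1 - d)^2 * (s * y)] from the weight on the window. *)
pose g := s * (1 - k / 2 + (1 - d) ^+ 2) / (1 + d).
have gl : l < g.
  rewrite /g ltr_pdivlMr// dl.
  rewrite -subr_gt0 (_ : _ - _ = s * (- k / 2 + 6 * d + 11 * d ^+ 2)); last by ring.
  by rewrite -k8 mulr_gt0//; lra.
(* The room between [1 - k] and [1 - k / 2]: [a * sqrt n = s * y * (k / 2)] absorbs the factor
   [2 * expR J * (1 + 1 / (t * k))]. *)
pose a := s * k / (2 * (1 + d)).
have a0 : 0 < a by apply: divr_gt0; apply: mulr_gt0.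
near=> n.
have n0 : (0 < n)%N by near: n; exists 1%N.
set r := Num.sqrt (n%:R : R).
have r0 : 0 < r by rewrite sqrtr_gt0 ltr0n.
pose y := r / (1 + d).
have y0 : 0 < y by rewrite divr_gt0.
have ny : Num.sqrt n%:R = (1 + d) * y by rewrite /y mulrC divfK// gt_eqF.
have yn : y <= n%:R.
  have r1 : 1 <= r by rewrite -sqrtr1 ler_wsqrtr// ler1n.
  rewrite -[leRHS](@sqr_sqrtr _ n%:R)// -/r /y ler_pdivrMr//.
  by rewrite -[leLHS]mulr1; apply: ler_pM => //; nra.
have H1 : 2 * expR J%:R * (1 + (s / y * k)^-1) <= expR (a * r).
  rewrite (_ : 2 * expR J%:R * _ = 2 * expR J%:R + 2 * expR J%:R / (s * k) * y); last first.
    by field; rewrite !gt_eqF.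
  apply: (@le_trans _ _ (2 * expR J%:R + 2 * expR J%:R / (s * k) * n%:R)).
    rewrite lerD2l; apply: ler_wpM2l => //.
    by apply: divr_ge0; [rewrite mulr_ge0// expR_ge0|exact: ltW (mulr_gt0 s0 k0)].
  by rewrite /r; near: n; exact: lin_le_expR_sqrt.
have H2 : 2 * expR J%:R + 2 * expR J%:R * n%:R <= expR ((g - l) * r).
  by rewrite /r; near: n; apply: lin_le_expR_sqrt; rewrite subr_gt0.
have t0 : 0 < s / y by rewrite divr_gt0.
have := fun M => p_gf_sum_le R d y n M d0 d1 y0 ny.
rewrite sE -/k => /(gf_p_lower R (s / y) _ J t0).
have ar : a * r = s * y * (k / 2) by rewrite /a /y; field; rewrite gt_eqF.
have E1 : expR (s * y * (1 - k / 2)) <= expR (zeta2 R J / (s / y) - J%:R) * expR J%:R.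
  rewrite -expRD subrK ler_expR ler_pdivlMr//.
  by apply: le_trans zJ; rewrite le_eqVlt; apply/orP; left; apply/eqP; field; rewrite gt_eqF.
(* The geometric part takes up at most half of the lower bound [E1]. *)
have E2 : 2 * expR J%:R * (expR (s * y * (1 - k)) * (1 + (s / y * k)^-1)) <=
    expR (s * y * (1 - k / 2)).
  rewrite (_ : s * y * (1 - k / 2) = s * y * (1 - k) + a * r); last by rewrite ar; field.
  by rewrite expRD mulrCA ler_pM2l ?expR_gt0.
set X := expR (s * y * (1 - k)) * _ in E2 *.
set Y := expR (zeta2 R J / _ - _) in E1 *.
set W := expR (- _) => YX.
have E3 : expR (s * y * (1 - k / 2)) <= 2 * expR J%:R * (n.+1%:R * (p n)%:R * W).
  have : Y * expR J%:R <= (X + n.+1%:R * (p n)%:R * W) * expR J%:R.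
    by rewrite ler_pM2r// expR_gt0.
  by move: E1 E2; set V := expR (s * y * _); lra.
have E4 : expR (g * r) <= 2 * expR J%:R * n.+1%:R * (p n)%:R.
  have -> : g * r = s * y * (1 - k / 2) + (1 - d) ^+ 2 * (s * y).
    by rewrite /g /y; field; rewrite gt_eqF.
  rewrite expRD -ler_pdivlMr ?expR_gt0// -expRN -/W.
  by apply: le_trans E3 _; rewrite !mulrA.
have E5 : expR (l * r) * expR ((g - l) * r) <= (2 * expR J%:R + 2 * expR J%:R * n%:R) * (p n)%:R.
  rewrite -expRD -mulrDl addrC subrK; apply: le_trans E4 _.
  by rewrite -natr1; lra.
rewrite -(ler_pM2r (expR_gt0 ((g - l) * r))); apply: le_trans E5 _.
by rewrite mulrC ler_wpM2l.
Unshelve. all: by end_near. Qed.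

(** * The lower bound for every set *)

Lemma limn_esup_le_near (R : realType) (u : nat -> \bar R) (B : R) :
  (forall e : R, 0 < e -> \forall n \near \oo, (u n <= (B + e)%:E)%E) ->
  (limn_esup u <= B%:E)%E.
Proof.
move=> H; apply/lee_addgt0Pr => e e0.
rewrite /limn_esup limf_esupE; apply: ge_ereal_inf.
exists (ereal_sup [set u n | n in [set n | (u n <= (B + e)%:E)%E]]).
  by exists [set n | (u n <= (B + e)%:E)%E] => //; exact: H.
by rewrite -EFinD; apply: ge_ereal_sup => _ [n /= un <-].
Qed.

Lemma near_le_of_limn_esup_lt (R : realType) (u : nat -> \bar R) (B : R) :
  0 < B -> (limn_esup u < B%:E)%E ->
  exists c : R, [/\ 0 <= c, c < B & \forall n \near \oo, (u n <= c%:E)%E].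
Proof.
move=> B0; rewrite /limn_esup limf_esupE => /ereal_inf_lt[_ [V VF <-] supV].
have uV n : V n -> (u n <= ereal_sup (u @` V))%E.
  by move=> Vn; apply: ereal_sup_ubound; exists n.
case: (ereal_sup _) supV uV => [c| |] //; last first.
  (* For [log_ratio] the supremum [-oo] means that [pA A n] vanishes for large [n]; then 0 is a real
     bound below [B]. *)
  move=> _ uV; exists 0; split=> //.
  by apply: filterS VF => n /uV/le_trans; apply; rewrite leNye.
rewrite lte_fin => cB uV; exists (Num.max 0 c); split.
- by rewrite le_max lexx.
- by rewrite gt_max B0 cB.
by apply: filterS VF => n /uV/le_trans; apply; rewrite lee_fin le_max lexx orbT.
Qed.

Lemma limn_esup_ge_often (R : realType) (u : nat -> \bar R) (B : \bar R) :
  (forall N, exists2 n, (N <= n)%N & (B <= u n)%E) -> (B <= limn_esup u)%E.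
Proof.
move=> H; rewrite /limn_esup limf_esupE; apply: le_ereal_inf_tmp => _ [V [N _ NV] <-].
have [n Nn Bn] := H N; apply: le_ereal_sup_tmp; exists (u n) => //.
by exists n => //; exact: NV.
Qed.

Lemma log_ratio_le (R : realType) (A : set nat) (beta c : R) (n : nat) :
  let D : R := (p (Num.truncn (beta * n%:R)))%:R in
  1 < D -> (log_ratio A beta n <= c%:E)%E = ((pA A n)%:R <= expR (c * ln D)).
Proof.
move=> D D1; have D0 : 0 < D by exact: lt_trans D1.
have lD : 0 < ln D by exact: ln_gt0.
rewrite /log_ratio -/D (lne_EFin D0) inver gt_eqF// lee_pdivrMr//.
(* Without partitions the quotient is [-oo], and both sides hold. *)
case: (pA A n) => [|k].
  by rewrite le0_lneNy// leNye expR_ge0.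
by rewrite lne_EFin// -EFinM lee_fin -ler_expR lnK// posrE ltr0n.
Qed.

Lemma near_truncn (R : realType) (beta : R) (P : nat -> Prop) : 0 < beta ->
  (\forall n \near \oo, P n) ->
  \forall n \near \oo, P (Num.truncn (beta * n%:R)).
Proof.
move=> b0 [N _ NP]; exists (Num.truncn (N%:R / beta)).+1 => // n /= Nn.
have : N%:R / beta <= n%:R by rewrite (le_trans (ltW (truncnS_gt _)))// ler_nat.
rewrite ler_pdivrMr// mulrC => Nb.
by apply: NP => /=; rewrite truncn_ge_nat// mulr_ge0// ltW.
Qed.

Lemma near_p_truncn_gt1 (R : realType) (beta : R) : 0 < beta ->
  \forall n \near \oo, 1 < (p (Num.truncn (beta * n%:R)))%:R :> R.
Proof.
move=> b0; apply: (near_truncn R beta (fun m => 1 < (p m)%:R :> R)) => //.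
have s0 := sqrt_zeta2_gt0 R.
have : \forall n \near \oo, expR (sqrt_zeta2 R * Num.sqrt n%:R) <= (p n)%:R :> R.
  by apply: p_eventually_ge; [exact: ltW|lra].
case=> N _ H; exists N.+1 => // n /= Nn; apply: lt_le_trans (H n (ltnW Nn)).
by rewrite expR_gt1 mulr_gt0// sqrtr_gt0 ltr0n (leq_trans _ Nn).
Qed.

Lemma prod_ge_count (R : realType) (A : set nat) (x : R) (N : nat) :
  A `<=` positives -> 0 <= x -> x < 1 ->
  (1 - x ^+ N)^-1 ^+ count_upto A N <= \prod_(1 <= a < N.+1 | a \in A) (1 - x ^+ a)^-1.
Proof.
move=> Apos x0 x1.
have -> : (1 - x ^+ N)^-1 ^+ count_upto A N = \prod_(1 <= a < N.+1 | a \in A) (1 - x ^+ N)^-1.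
  by rewrite big_const_seq iter_mulr_1 /index_iota subn1.
rewrite big_nat_cond [leRHS]big_nat_cond; apply: ler_prod => a /andP[/andP[a0 aN] aA].
have H (b : nat) : (0 < b)%N -> 0 < 1 - x ^+ b.
  by move=> b0; rewrite subr_gt0 exprn_ilt1// -lt0n.
rewrite invr_ge0 ltW ?H ?(leq_trans a0 aN)//=.
rewrite lef_pV2 ?posrE ?H ?(leq_trans a0 aN)// lerD2l lerN2 ler_wiXn2l// ltW//.
Qed.

(** At [t = ln 2 / N] one has [x ^+ N = 1/2], so every part up to [N] contributes a factor of at
    least 2 to the generating function. *)
Lemma two_exp_count_le (R : realType) (A : set nat) (C l e : R) (N : nat) :
  A `<=` positives -> 0 <= C -> (forall n, (pA A n)%:R <= C * expR (l * Num.sqrt n%:R)) ->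
  0 < e -> e < 1 -> (0 < N)%N ->
  2 ^+ count_upto A N <=
    C * expR (l ^+ 2 / (4 * ln 2 * (1 - e)) * N%:R) * (1 + N%:R / (e * ln 2)) :> R.
Proof.
move=> Apos C0 HC e0 e1 N0.
have l2 : 0 < ln 2 :> R by rewrite ln_gt0// ltr1n.
have NR : 0 < N%:R :> R by rewrite ltr0n.
pose t : R := ln 2 / N%:R.
have t0 : 0 < t by exact: divr_gt0.
set x := expR (- t).
have x0 : 0 <= x by exact: expR_ge0.
have x1 : x < 1 by rewrite expR_lt1 oppr_lt0.
have xN : x ^+ N = 2^-1.
  by rewrite expRNX /t divfK ?gt_eqF// expRN lnK ?posrE.
have := prod_ge_count R A x N Apos x0 x1.
rewrite xN (_ : (1 - 2^-1)^-1 = 2); last by field.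
move=> /le_trans; apply.
apply: pA_gf_lower => // M.
have e1' : 0 < 1 - e by rewrite subr_gt0.
set K := l ^+ 2 / _ * _.
(* The share [t * e * m] of the exponent is kept to make the series geometric; completing the square
   in [sqrt m] bounds the rest by [K]. *)
have term m : (pA A m)%:R * x ^+ m <= C * expR K * expR (- (t * e)) ^+ m.
  apply: le_trans (ler_wpM2r (exprn_ge0 m x0) (HC m)) _.
  rewrite !expRNX -!mulrA -!expRD ler_wpM2l// ler_expR.
  set r := Num.sqrt m%:R.
  have -> : m%:R = r ^+ 2 by rewrite sqr_sqrtr.
  rewrite -subr_ge0.
  rewrite (_ : _ - _ = (l - 2 * t * (1 - e) * r) ^+ 2 / (4 * t * (1 - e))).
    apply: divr_ge0; first exact: sqr_ge0.
    by apply/ltW/mulr_gt0 => //; exact: mulr_gt0.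
  by rewrite /K /t; field; rewrite !gt_eqF.
apply: (le_trans (ler_sum _ (fun (m : 'I_M) _ => term m))).
rewrite -mulr_sumr ler_wpM2l ?mulr_ge0 ?expR_ge0//.
have te0 : 0 < t * e by exact: mulr_gt0.
apply: le_trans (geom_sum_le _ _ _ (expR_ge0 _) _) _.
  by rewrite expR_lt1 oppr_lt0.
have /andP[_ H] := inv_1BexpRN_bounds R _ te0; apply: le_trans H _.
by rewrite /t lerD2l le_eqVlt; apply/orP; left; apply/eqP; field; rewrite !gt_eqF.
Qed.

Lemma upper_density_le_growth (R : realType) (A : set nat) (l : R) :
  A `<=` positives -> 0 <= l ->
  (\forall n \near \oo, (pA A n)%:R <= expR (l * Num.sqrt n%:R)) ->
  (upper_density R A <= (l ^+ 2 / (4 * ln 2 ^+ 2))%:E)%E.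
Proof.
move=> Apos l0 [N0 _ HN0].
have l2 : 0 < ln 2 :> R by rewrite ln_gt0// ltr1n.
(* This constant extends the growth bound to the finitely many [n < N0]. *)
pose C : R := 1 + \sum_(m < N0) (pA A m)%:R.
have C1 : 1 <= C by rewrite lerDl sumr_ge0.
have C0 : 0 <= C by exact: le_trans C1.
have HC n : (pA A n)%:R <= C * expR (l * Num.sqrt n%:R).
  have E1 : 1 <= expR (l * Num.sqrt n%:R).
    by rewrite -expR0 ler_expR mulr_ge0// sqrtr_ge0.
  have [nN|Nn] := ltnP n N0.
    apply: (@le_trans _ _ C); last by rewrite ler_peMr.
    by rewrite /C (bigD1 (Ordinal nN)) //= addrCA lerDl addr_ge0// sumr_ge0.
  by apply: le_trans (HN0 n Nn) _; rewrite ler_peMl ?expR_ge0.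
apply: limn_esup_le_near => e e0.
set B := l ^+ 2 / (4 * ln 2 ^+ 2).
have B0 : 0 <= B by rewrite divr_ge0 ?sqr_ge0// mulr_ge0// sqr_ge0.
(* Chosen so that [(B + e) * (1 - d) = B + e / 2], hence [B / (1 - d) <= B + e / 2]; the other half
   of [e] absorbs the linear factor. *)
pose d := (e / 2) / (B + e).
have d0 : 0 < d by rewrite !divr_gt0// ltr_wpDl.
have d1 : d < 1 by rewrite /d ltr_pdivrMr ?ltr_wpDl// mul1r; lra.
have d1' : 0 < 1 - d by rewrite subr_gt0.
have Bd : B / (1 - d) <= B + e / 2.
  rewrite ler_pdivrMr// -(ler_pM2r (ltr_wpDl B0 e0)).
  rewrite (_ : _ * (1 - d) * _ = (B + e / 2) * (B + e / 2)); last first.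
    by rewrite /d; field; rewrite gt_eqF// ltr_wpDl.
  nra.
have c0 : 0 < ln 2 * (e / 2) :> R by rewrite mulr_gt0// divr_gt0.
near=> N.
have N1 : (0 < N)%N by near: N; exists 1%N.
have NR : 0 < N%:R :> R by rewrite ltr0n.
have H1 : C + C / (d * ln 2) * N%:R <= expR (ln 2 * (e / 2) * Num.sqrt N%:R).
  by near: N; exact: lin_le_expR_sqrt.
rewrite lee_fin ler_pdivrMr// -(ler_pM2r l2) -ler_expR.
have -> : expR ((count_upto A N)%:R * ln 2) = 2 ^+ count_upto A N :> R.
  by rewrite expRM_natl lnK ?posrE.
apply: le_trans (two_exp_count_le R A C l d N Apos C0 HC d0 d1 N1) _.
rewrite mulrAC (_ : C * _ = C + C / (d * ln 2) * N%:R); last by ring.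
apply: (@le_trans _ _ (expR (ln 2 * (e / 2) * N%:R) *
   expR (l ^+ 2 / (4 * ln 2 * (1 - d)) * N%:R))).
  rewrite ler_pM2r ?expR_gt0//; apply: le_trans H1 _.
  rewrite ler_expR ler_pM2l// -[leRHS](@sqr_sqrtr _ N%:R)// expr2.
  by rewrite ler_peMl ?sqrtr_ge0// -[leLHS]sqrtr1 ler_wsqrtr// ler1n.
rewrite -expRD ler_expR -mulrDl.
rewrite (_ : (B + e) * N%:R * ln 2 = ln 2 * (B + e) * N%:R); last by ring.
rewrite ler_pM2r//.
rewrite (_ : l ^+ 2 / _ = ln 2 * (B / (1 - d))); last first.
  by rewrite /B; field; rewrite !gt_eqF.
by rewrite -mulrDr ler_pM2l//; lra.
Unshelve. all: by end_near. Qed.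

(** If eventually [log_ratio <= c < ln 2 / s], the upper bound for [p] gives growth rate
    [l = 2 * c * s * sqrt beta], and [upper_density_le_growth] gives density at most
    [(c * s / ln 2)^2 * beta < beta]. *)
Lemma limsup_log_ratio_ge (R : realType) (A : set nat) (beta : R) :
  A `<=` positives -> 0 < beta -> upper_density R A = beta%:E ->
  ((ln 2 / sqrt_zeta2 R)%:E <= limn_esup (log_ratio A beta))%E.
Proof.
move=> Apos b0 dA; rewrite leNgt; apply/negP.
have := sqrt_zeta2_gt0 R; move sE : (sqrt_zeta2 R) => s s0.
have l2 : 0 < ln 2 :> R by rewrite ln_gt0// ltr1n.
move=> /near_le_of_limn_esup_lt[|c [c0 cB Hc]]; first exact: divr_gt0.
pose l := c * (2 * s * Num.sqrt beta).
have := @upper_density_le_growth R A l Apos.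
have l0 : 0 <= l by rewrite mulr_ge0// mulr_ge0 ?sqrtr_ge0// mulr_ge0 ?ltW.
move=> /(_ l0); rewrite dA lee_fin => H.
have : beta <= l ^+ 2 / (4 * ln 2 ^+ 2).
  apply: H; near=> n.
  have D1 : 1 < (p (Num.truncn (beta * n%:R)))%:R :> R.
    by near: n; exact: near_p_truncn_gt1.
  have : (log_ratio A beta n <= c%:E)%E by near: n.
  rewrite (log_ratio_le R A beta c n D1) => /le_trans; apply.
  rewrite ler_expR /l -mulrA ler_wpM2l// -ler_expR lnK; last first.
    by rewrite posrE (lt_trans _ D1).
  apply: le_trans (p_le_expR_sqrt R _) _; rewrite sE ler_expR -[leRHS]mulrA ler_pM2l ?mulr_gt0//.
  by rewrite -sqrtrM ?(ltW b0)// ler_wsqrtr// truncn_le mulr_ge0// ltW.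
rewrite leNgt => /negP; apply.
rewrite ltr_pdivrMr ?mulr_gt0 ?exprn_gt0// /l !exprMn sqr_sqrtr ?(ltW b0)//.
move: cB; rewrite ltr_pdivlMr// => cB.
have : (c * s) ^+ 2 < ln 2 ^+ 2.
  have cs0 : 0 <= c * s by rewrite mulr_ge0// ltW.
  have l20 := ltW l2; nra.
rewrite -(ltr_pM2r b0) exprMn; lra.
Unshelve. all: by end_near. Qed.

(** * The binary entropy inequality *)

(** At [r = sqrt (S / M)] this is the entropy [(S + M) ln (S + M) - S ln S - M ln M] divided by
    [sqrt (S * M)]. *)
Definition entropy_fun (R : realType) (r : R) : R :=
  (r + r^-1) * ln (1 + r ^+ 2) - 2 * r * ln r.

Lemma is_derive_entropy_fun (R : realType) (x : R) : 0 < x ->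
  is_derive x 1 (@entropy_fun R) ((1 - x ^- 2) * ln (1 + x ^+ 2) - 2 * ln x).
Proof.
move=> x0.
have x20 : 0 < 1 + x ^+ 2 by rewrite ltr_wpDr ?sqr_ge0.
have dV : is_derive x 1 (fun y : R => y + y^-1) (1 - x ^- 2).
  apply: is_deriveD.
  by apply: is_derive_eq; [apply: is_deriveV; rewrite gt_eqF|rewrite /GRing.scale /= mulr1].
have dL : is_derive x 1 (fun y : R => ln (1 + y ^+ 2)) ((1 + x ^+ 2)^-1 * (2 * x)).
  apply: (@is_derive1_comp R (@ln R) (fun y => 1 + y ^+ 2)).
    exact: is_derive1_ln.
  have -> : (fun y : R => 1 + y ^+ 2) = cst 1 + (@id R) ^+ 2.
    by apply/funext => y; rewrite /= exprfctE.
  by apply: is_derive_eq; rewrite /GRing.scale /= add0r expr1 mulr1.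
have dl : is_derive x 1 (fun y : R => 2 * y * ln y) (2 * ln x + 2).
  have -> : (fun y : R => 2 * y * ln y) = (fun y => 2 * y) * (@ln R) by [].
  have d2 : is_derive x 1 (fun y : R => 2 * y) 2.
    by apply: is_derive_eq; rewrite /GRing.scale /= mulr1.
  have dln := is_derive1_ln x0.
  apply: is_derive_eq; rewrite /GRing.scale /=.
  by field; rewrite gt_eqF.
have -> : @entropy_fun R = (fun y => y + y^-1) * (fun y => ln (1 + y ^+ 2)) -
   (fun y => 2 * y * ln y) by [].
apply: is_derive_eq; rewrite /GRing.scale /=.
by field; rewrite !gt_eqF.
Qed.

(** The function increases on [(0, 1]], equals [2 * ln 2] at 1 and is invariant under
    [r -> 1 / r]. *)
Lemma entropy_fun_le (R : realType) (r : R) : 0 < r -> entropy_fun R r <= 2 * ln 2.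
Proof.
have E1 : entropy_fun R 1 = 2 * ln 2.
  by rewrite /entropy_fun ln1 invr1 expr1n mulr0 subr0.
have H (x : R) : 0 < x -> x <= 1 -> entropy_fun R x <= 2 * ln 2.
  move=> x0 x1; rewrite -E1.
  apply: (@le_of_derive_ge0 R (@entropy_fun R)
    (fun y => (1 - y ^- 2) * ln (1 + y ^+ 2) - 2 * ln y) x 1) => //.
    by move=> y /andP[xy _]; apply: is_derive_entropy_fun; exact: lt_le_trans xy.
  move=> y /andP[xy y1]; have y0 : 0 < y by exact: lt_trans xy.
  have y20 : 0 < y ^+ 2 by rewrite exprn_gt0.
  have y21 : y ^+ 2 <= 1 by rewrite exprn_ile1// ltW.
  (* With [h2], the derivative is at least [(1 - y^-2) * y^2 - (y^2 - 1) = 0]. *)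
  have h1 : ln (1 + y ^+ 2) <= y ^+ 2 by apply: le_ln1Dx; rewrite (lt_trans _ y20).
  have h2 : ln (y ^+ 2) <= y ^+ 2 - 1.
    have := @le_ln1Dx R (y ^+ 2 - 1); rewrite [1 + _]addrC subrK; apply.
    by rewrite ltrBrDr addrC subrr.
  rewrite lnXn// -mulr_natl in h2.
  have h3 : (y ^- 2 - 1) * ln (1 + y ^+ 2) <= (y ^- 2 - 1) * y ^+ 2.
    by rewrite ler_wpM2l// subr_ge0 invf_ge1.
  rewrite [X in _ <= X]mulrBl mulVf ?gt_eqF// mul1r in h3; lra.
move=> r0; have [r1|r1] := leP r 1; first exact: H.
have -> : entropy_fun R r = entropy_fun R r^-1.
  have r20 : 0 < 1 + r ^+ 2 by rewrite ltr_wpDr ?sqr_ge0.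
  rewrite /entropy_fun invrK lnV// exprVn.
  rewrite (_ : 1 + r ^- 2 = (1 + r ^+ 2) / r ^+ 2); last by field; rewrite gt_eqF.
  rewrite ln_div ?posrE ?exprn_gt0// lnXn// -mulr_natl.
  by field; rewrite gt_eqF.
by apply: H; rewrite ?invr_gt0// invf_le1// ltW.
Qed.

Lemma entropy_bound (R : realType) (S M : R) : 0 < S -> 0 < M ->
  - S * ln (S / (S + M)) - M * ln (M / (S + M)) <= 2 * ln 2 * Num.sqrt (S * M).
Proof.
move=> S0 M0.
have a0 : 0 < Num.sqrt S by rewrite sqrtr_gt0.
have b0 : 0 < Num.sqrt M by rewrite sqrtr_gt0.
have SE : S = Num.sqrt S ^+ 2 by rewrite sqr_sqrtr// ltW.
have ME : M = Num.sqrt M ^+ 2 by rewrite sqr_sqrtr// ltW.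
rewrite sqrtrM ?(ltW S0)//; move: (Num.sqrt S) (Num.sqrt M) a0 b0 SE ME => a b a0 b0 -> ->.
have ab0 : 0 < a ^+ 2 + b ^+ 2 by rewrite addr_gt0 ?exprn_gt0.
have r0 : 0 < a / b by exact: divr_gt0.
have := entropy_fun_le R (a / b) r0; rewrite /entropy_fun.
rewrite (_ : 1 + (a / b) ^+ 2 = (a ^+ 2 + b ^+ 2) / b ^+ 2); last by field; rewrite gt_eqF.
rewrite !ln_div ?posrE ?exprn_gt0// !lnXn// !(mulr2n (ln _)).
move=> /(ler_wpM2r (ltW (mulr_gt0 a0 b0))) H.
apply: le_trans H.
rewrite le_eqVlt; apply/orP; left; apply/eqP.
by field; rewrite !gt_eqF.
Qed.

(** * The extremal set *)

Definition block_end (k : nat) : nat := 2 ^ (4 ^ k).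

Definition block_set (R : realType) (beta : R) : set nat :=
  [set a : nat | exists k, (1 - beta) * (block_end k)%:R < a%:R /\ (a <= block_end k)%N].

Lemma block_endS (k : nat) : block_end k.+1 = (block_end k ^ 4)%N.
Proof. by rewrite /block_end expnSr expnM. Qed.

Lemma leq_block_end (j k : nat) : (j <= k)%N -> (block_end j <= block_end k)%N.
Proof. by move=> jk; rewrite leq_exp2l// leq_exp2l. Qed.

Lemma ltn_block_end (k : nat) : (k < block_end k)%N.
Proof.
apply: (@leq_trans (4 ^ k).+1); first by rewrite ltnS ltnW// ltn_expl.
by rewrite ltn_expl.
Qed.

Lemma block_end_gt0 (k : nat) : (0 < block_end k)%N.
Proof. by rewrite expn_gt0. Qed.

Lemma block_set_positives (R : realType) (beta : R) : beta < 1 ->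
  block_set R beta `<=` positives.
Proof.
move=> b1 a [k [ka _]]; rewrite /positives /= -(ltr0n R).
by apply: le_lt_trans ka; rewrite mulr_ge0// subr_ge0 ltW.
Qed.

(** Block [k.+1] is the last one starting below [n]. The hypothesis puts the start of block 1 below
    [n], so block [k] always exists. *)
Lemma block_set_upto (R : realType) (beta : R) (n : nat) :
  0 < beta -> beta < 1 -> (1 - beta) * (block_end 1)%:R < n%:R ->
  exists k, [/\ (1 - beta) * (block_end k.+1)%:R < n%:R,
    n%:R <= (1 - beta) * (block_end k.+2)%:R &
    forall a, a \in block_set R beta -> (a <= n)%N -> (a <= block_end k)%N \/
      (1 - beta) * (block_end k.+1)%:R < a%:R /\ (a <= block_end k.+1)%N].
Proof.
move=> b0 b1 n1.
have b10 : 0 < 1 - beta by rewrite subr_gt0.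
pose P k := (1 - beta) * (block_end k.+1)%:R < n%:R.
have exP : exists k, P k by exists 0%N.
have ubP k : P k -> (k <= Num.truncn (n%:R / (1 - beta)))%N.
  rewrite /P mulrC -ltr_pdivlMr// => H.
  rewrite truncn_ge_nat ?divr_ge0// ?(ltW b10)//; apply: ltW; apply: lt_trans H.
  by rewrite ltr_nat (leq_trans _ (ltn_block_end k.+1)).
case: (ex_maxnP exP ubP) => k Pk kmax; exists k; split=> //.
  by rewrite leNgt; apply/negP => /(kmax k.+1); rewrite ltnn.
move=> a; rewrite in_setE => -[j [ja aj]] an.
have jk : (j <= k.+1)%N.
  case: j ja {aj} => // j ja; rewrite ltnS; apply: kmax.
  by apply: lt_le_trans ja _; rewrite ler_nat.
move: jk; rewrite leq_eqVlt => /orP[/eqP jk|jk]; first by right; rewrite -jk.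
by left; apply: leq_trans aj _; exact: leq_block_end.
Qed.

Lemma count_interval_le (n c v : nat) :
  (count (fun a => (c < a <= v)%N) (iota 1 n) <= v - c)%N.
Proof.
rewrite -size_filter -[leqRHS](size_iota c.+1); apply: uniq_leq_size.
  by rewrite filter_uniq// iota_uniq.
move=> a; rewrite mem_filter mem_iota => /andP[/andP[ca av] _].
by rewrite mem_iota ca /= addSn ltnS subnKC// (leq_trans (ltnW ca)).
Qed.

Lemma count_gt_iota (n c : nat) : (count (fun a => c < a)%N (iota 1 n) = n - c)%N.
Proof.
elim: n => [|n IH]; first by rewrite sub0n.
rewrite -[n.+1]addn1 iotaD count_cat IH /= addn0 add1n.
by case: ltnP => /= H; lia.
Qed.

Lemma count_or (T : Type) (p q : pred T) (s : seq T) :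
  (count (fun x => p x || q x) s <= count p s + count q s)%N.
Proof. by rewrite -[leqRHS]count_predUI leq_addr. Qed.

Lemma subn_truncn_le (R : realType) (u : R) (v : nat) : 0 <= u -> u <= v%:R + 1 ->
  (v - Num.truncn u)%:R <= v%:R + 1 - u.
Proof.
move=> u0 uv; have := truncnS_gt u; rewrite -natr1 => H.
have [cv|vc] := leqP (Num.truncn u) v; first by rewrite natrB//; lra.
by rewrite (eqP (ltnW vc : (v - _ == 0)%N)); lra.
Qed.

(* [w] lies between the blocks: earlier parts are O(w), the current block end is at least w. *)
Lemma block_set_scales (R : realType) (beta : R) (n : nat) :
  0 < beta -> beta < 1 -> (1 - beta) * (block_end 1)%:R < n%:R ->
  let w := Num.sqrt (Num.sqrt (n%:R : R)) in
  exists L V : nat, [/\ L%:R <= w / (1 - beta), w <= V%:R :> R,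
   (1 - beta) * V%:R < n%:R &
   forall a, a \in block_set R beta -> (a <= n)%N -> (a <= L)%N \/
      (Num.truncn ((1 - beta) * V%:R) < a <= V)%N].
Proof.
move=> b0 b1 n1 w; have b10 : 0 < 1 - beta by rewrite subr_gt0.
have [k [nk kn H]] := block_set_upto R beta n b0 b1 n1.
have w0 : 0 <= w by rewrite sqrtr_ge0.
have w4 : w ^+ 4 = n%:R by rewrite (exprM _ 2 2) !sqr_sqrtr// sqrtr_ge0.
exists (block_end k), (block_end k.+1); split=> //.
(* Fourth powers bring in [block_end k.+1 = block_end k ^ 4]. *)
- rewrite ler_pdivlMr// -(@ler_pXn2r _ 4)// ?nnegrE//; last by rewrite mulr_ge0// ltW.
  rewrite exprMn w4; apply: ltW; apply: le_lt_trans nk.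
  rewrite block_endS natrX mulrC ler_wpM2r ?exprn_ge0//.
  by rewrite exprS ler_piMr ?(ltW b10)// exprn_ile1 ?(ltW b10)// gerBl ltW.
- rewrite -(@ler_pXn2r _ 4)// ?nnegrE// w4; apply: le_trans kn _.
  by rewrite [block_end k.+2]block_endS natrX ler_piMl ?exprn_ge0//; lra.
move=> a aA an; have [|[ua aV]] := H a aA an; first by left.
by right; rewrite aV andbT truncn_lt_nat// mulr_ge0// ltW.
Qed.

(** Once [beta * block_end k > 2], block [k] contains two consecutive integers. *)
Lemma block_set_gcd (R : realType) (beta : R) : 0 < beta -> beta < 1 -> is_gcd (block_set R beta) 1.
Proof.
move=> b0 b1; split=> [a _|d Hd]; first exact: dvd1n.
pose k := (Num.truncn (2 / beta)).+1.
have kE : 2 < beta * (block_end k)%:R.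
  rewrite mulrC -ltr_pdivrMr//; apply: lt_trans (truncnS_gt _) _.
  by rewrite ltr_nat ltn_block_end.
have E0 := block_end_gt0 k.
have H1 : (d %| block_end k)%N.
  by apply: Hd; exists k; split=> //; lra.
have H2 : (d %| (block_end k).-1)%N.
  apply: Hd; exists k; split; last exact: leq_pred.
  by rewrite -subn1 natrB//; lra.
by move: H1; rewrite -(prednK E0) -addn1 dvdn_addr.
Qed.

Lemma near_natr_ge (R : realType) (c : R) : \forall n \near \oo, c < n%:R.
Proof.
exists (Num.truncn c).+1 => // n /= cn.
by apply: lt_le_trans (truncnS_gt c) _; rewrite ler_nat.
Qed.

Lemma near_root4_ge (R : realType) (c : R) :
  \forall n \near \oo, c < Num.sqrt (Num.sqrt n%:R).
Proof.
have := near_natr_ge R (`|c| ^+ 4); apply: filterS => n cn.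
apply: le_lt_trans (ler_norm c) _.
rewrite -(@ltr_pXn2r _ 4)// ?nnegrE ?sqrtr_ge0//.
by rewrite [ltRHS](exprM _ 2 2) !sqr_sqrtr// sqrtr_ge0.
Qed.

Lemma block_set_density (R : realType) (beta : R) : 0 < beta -> beta < 1 ->
  upper_density R (block_set R beta) = beta%:E.
Proof.
move=> b0 b1; have b10 : 0 < 1 - beta by rewrite subr_gt0.
apply/eqP; rewrite eq_le; apply/andP; split.
  apply: limn_esup_le_near => e e0; near=> n.
  have n1 : (1 - beta) * (block_end 1)%:R < n%:R by near: n; exact: near_natr_ge.
  have [L [V [Lw wV Vn H]]] := block_set_scales R beta n b0 b1 n1.
  set w := Num.sqrt _ in Lw wV.
  have w4 : w ^+ 4 = n%:R by rewrite (exprM _ 2 2) !sqr_sqrtr// sqrtr_ge0.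
  have w1 : 1 < w by rewrite /w; near: n; exact: near_root4_ge.
  have we : ((1 - beta)^-1 + 1) / e < w by rewrite /w; near: n; exact: near_root4_ge.
  have n0 : 0 < n%:R :> R by rewrite -w4 exprn_gt0// (lt_trans _ w1).
  rewrite lee_fin ler_pdivrMr//.
  set c := Num.truncn _ in H.
  have Hc : (count_upto (block_set R beta) n <= L + (minn n V - c))%N.
    apply: leq_trans (_ : count (fun a => (0 < a <= L)%N || (c < a <= minn n V)%N) (iota 1 n) <= _)%N.
      rewrite /count_upto -!size_filter; apply: uniq_leq_size; first by rewrite filter_uniq// iota_uniq.
      move=> a; rewrite !mem_filter mem_iota => /andP[aA /andP[a0 an]].
      rewrite a0 an/= andbT; have an' : (a <= n)%N by rewrite -ltnS -add1n.
      case: (H a aA an') => [->//|/andP[ca aV]]; rewrite ca leq_min an' aV orbT//.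
    apply: leq_trans (count_or _ _ _ _) _; apply: leq_add.
      by rewrite -[leqRHS]subn0; exact: count_interval_le.
    exact: count_interval_le.
  apply: (@le_trans _ _ (L + (minn n V - c))%:R); first by rewrite ler_nat.
  rewrite natrD.
  have mn : (minn n V)%:R <= n%:R :> R by rewrite ler_nat geq_minl.
  (* Replacing [V] by the minimum leaves at most [beta * minn n V + 1] elements of the current
     block; the [L] earlier ones are [O(n^(1/4))]. *)
  have mV : (1 - beta) * (minn n V)%:R <= (1 - beta) * V%:R :> R.
    by rewrite ler_pM2l// ler_nat geq_minr.
  have bV0 : 0 <= (1 - beta) * V%:R by rewrite mulr_ge0// ltW.
  have bVm : (1 - beta) * V%:R <= (minn n V)%:R + 1.
    rewrite /minn; case: ifP => _; first by lra.
    by have := ler0n R V; have := ltW b0; nra.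
  have := subn_truncn_le R _ (minn n V) bV0 bVm; rewrite -/c => Hm.
  have bm : beta * (minn n V)%:R <= beta * n%:R by rewrite ler_pM2l.
  have Lf : L%:R + 1 <= e * n%:R.
    move: we; rewrite ltr_pdivrMr// => we.
    have H1 : L%:R + 1 <= ((1 - beta)^-1 + 1) * w by rewrite mulrDl mul1r [_^-1 * _]mulrC; lra.
    apply: le_trans H1 _; rewrite -w4.
    have w0 : 0 < w by exact: lt_trans w1.
    apply: (@le_trans _ _ (w * e * w)); first by rewrite ler_pM2r// ltW.
    rewrite (_ : w * e * w = e * w ^+ 2); last by ring.
    by rewrite ler_pM2l// ler_weXn2l// ltW.
  lra.
(* At a block end the last block alone has density at least [beta]. *)
apply: limn_esup_ge_often => K; exists (block_end K); first exact: ltnW (ltn_block_end K).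
rewrite lee_fin.
set V := block_end K.
have V0 : 0 < V%:R :> R by rewrite ltr0n block_end_gt0.
rewrite ler_pdivlMr//.
set u := (1 - beta) * V%:R.
have u0 : 0 <= u by rewrite mulr_ge0// ltW.
have uV : u <= V%:R by rewrite /u; have := mulr_gt0 b0 V0; lra.
apply: (@le_trans _ _ (V - Num.truncn u)%:R).
  have := truncn_le u; rewrite u0 => /idP cu.
  rewrite natrB; first by rewrite /u in cu *; lra.
  by rewrite -(ler_nat R); exact: le_trans uV.
rewrite ler_nat -(count_gt_iota V) /count_upto -!size_filter.
apply: uniq_leq_size; first by rewrite filter_uniq// iota_uniq.
move=> a; rewrite !mem_filter mem_iota => /andP[ca /andP[a0 aV]].
rewrite a0 aV !andbT in_setE; exists K; split; last by rewrite -ltnS -add1n.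
by rewrite -truncn_lt_nat.
Unshelve. all: by end_near. Qed.

(** Meant for a crude bound [G1] on the few parts of earlier blocks and a sharp bound [G2] on the
    current block. *)
Lemma prod_two_ranges_le (R : realType) (A : set nat) (F : nat -> R) (n L c V : nat)
    (G1 G2 : R) :
  1 <= G1 -> 1 <= G2 ->
  (forall a, (0 < a <= n)%N -> a \in A -> 0 <= F a) ->
  (forall a, (0 < a <= n)%N -> a \in A -> F a <= G1) ->
  (forall a, (0 < a <= n)%N -> a \in A -> (a <= L)%N \/ ((c < a <= V)%N /\ F a <= G2)) ->
  \prod_(1 <= a < n.+1 | a \in A) F a <= G1 ^+ L * G2 ^+ (V - c).
Proof.
move=> G11 G21 F0 FG1 H.
have const G (P : pred nat) : \prod_(1 <= a < n.+1) (if P a then G else 1) =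
    G ^+ count P (iota 1 n).
  by rewrite -big_mkcond big_const_seq iter_mulr_1 /index_iota subn1.
apply: (@le_trans _ _ (\prod_(1 <= a < n.+1)
    ((if (0 < a <= L)%N then G1 else 1) * (if (c < a <= V)%N then G2 else 1)))).
  rewrite big_mkcond /= !big_nat; apply: ler_prod => a; rewrite ltnS => an.
  have i1 : 1 <= (if (0 < a <= L)%N then G1 else 1) by case: ifP.
  have i2 : 1 <= (if (c < a <= V)%N then G2 else 1) by case: ifP.
  case: ifPn => aA; last by rewrite ler01 /= mulr_ege1.
  rewrite F0//=; have [aL|[aV FG2]] := H a an aA.
    have /andP[a0 _] := an.
    by rewrite a0 aL/= (le_trans (FG1 a an aA))// ler_peMr// (le_trans ler01).
  by rewrite aV (le_trans FG2)// ler_peMl// (le_trans ler01).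
rewrite big_split /= !const; apply: ler_pM.
- by rewrite exprn_ge0// (le_trans ler01).
- by rewrite exprn_ge0// (le_trans ler01).
- by rewrite ler_weXn2l// -[leqRHS]subn0 count_interval_le.
- by rewrite ler_weXn2l// count_interval_le.
Qed.

(** With [q = x ^ u] at the block start [u], the current block gives [(1 - q)^(-M)] and
    [x^(-n) = q^(-S)]; the optimal [q] is [S / (S + M)], which yields the entropy. Earlier blocks
    give [(1 - x)^(-L)], negligible because [L = O(n^(1/4))]. *)
Lemma pA_block_set_le (R : realType) (beta b' eta : R) :
  0 < beta -> beta < 1 -> beta < b' -> 0 < eta ->
  \forall n \near \oo, (pA (block_set R beta) n)%:R <=
    expR ((2 * ln 2 * Num.sqrt (b' / (1 - beta)) + eta) * Num.sqrt n%:R) :> R.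
Proof.
move=> b0 b1 bb' eta0; have b10 : 0 < 1 - beta by rewrite subr_gt0.
have l2 : 0 < ln 2 :> R by rewrite ln_gt0// ltr1n.
have c0 : 0 < eta * (1 - beta) by exact: mulr_gt0.
near=> n.
have n1 : (1 - beta) * (block_end 1)%:R < n%:R by near: n; exact: near_natr_ge.
have [L [V [Lw wV Vn H]]] := block_set_scales R beta n b0 b1 n1.
set w := Num.sqrt (Num.sqrt _) in Lw wV.
have w2 : w ^+ 2 = Num.sqrt n%:R by rewrite sqr_sqrtr// sqrtr_ge0.
have w1 : 1 < w by rewrite /w; near: n; exact: near_root4_ge.
have wb : (b' - beta)^-1 < w by rewrite /w; near: n; exact: near_root4_ge.
have wl : 1 + 2 * n%:R <= expR (eta * (1 - beta) * w).
  by rewrite /w; near: n; exact: lin_le_expR_root4.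
have n0 : 0 < n%:R :> R by near: n; exact: near_natr_ge.
have w0 : 0 < w by exact: lt_trans w1.
have V0 : 0 < V%:R :> R by exact: lt_le_trans wV.
have u0 : 0 < (1 - beta) * V%:R by exact: mulr_gt0.
(* The 1 covers the rounding of the block start. *)
pose M := beta * V%:R + 1.
have M0 : 0 < M by rewrite ltr_wpDl// mulr_ge0// ltW.
have M1 : 1 <= M by rewrite lerDr mulr_ge0// ltW.
have HM : (V - Num.truncn ((1 - beta) * V%:R))%:R <= M.
  apply: le_trans (subn_truncn_le R _ V (ltW u0) _) _.
    by rewrite /M in M0; lra.
  by rewrite /M; lra.
move: H HM; set u := (1 - beta) * V%:R in Vn u0 *; set c := Num.truncn u => H HM.
pose S := n%:R / u.
have S0 : 0 < S by exact: divr_gt0.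
have SM0 : 0 < S + M by exact: addr_gt0.
pose q := S / (S + M).
have q0 : 0 < q by exact: divr_gt0.
have q1 : 1 - q = M / (S + M) by rewrite /q; field; rewrite gt_eqF.
have q10 : 0 < 1 - q by rewrite q1 divr_gt0.
have lq : 1 - q <= - ln q.
  have := @le_ln1Dx R (q - 1); rewrite [1 + _]addrC subrK; lra.
pose t := - ln q / u.
have t0 : 0 < t by apply: divr_gt0 => //; exact: lt_le_trans lq.
set x := expR (- t).
have x0 : 0 < x by exact: expR_gt0.
have x1 : x < 1 by rewrite expR_lt1 oppr_lt0.
have tu : expR (- (t * u)) = q.
  by rewrite /t divfK ?gt_eqF// opprK lnK.
have Fpos a : (0 < a)%N -> 0 < 1 - x ^+ a.
  by move=> a0; rewrite subr_gt0 exprn_ilt1 ?(ltW x0)// -lt0n.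
have G1 : 1 <= (1 - x)^-1 by rewrite invf_ge1 ?subr_gt0// gerBl ltW.
have G2 : 1 <= (1 - q)^-1 by rewrite invf_ge1// gerBl ltW.
have := pA_gf_upper R _ x n (block_set_positives R beta b1) (ltW x0) x1.
have : \prod_(1 <= a < n.+1 | a \in block_set R beta) (1 - x ^+ a)^-1 <=
    (1 - x)^-1 ^+ L * (1 - q)^-1 ^+ (V - c).
  apply: prod_two_ranges_le => // a /andP[a0 an] aA.
  - by rewrite invr_ge0 ltW// Fpos.
  - rewrite lef_pV2 ?posrE ?Fpos// ?subr_gt0// lerD2l lerN2.
    by rewrite -[leRHS]expr1 ler_wiXn2l ?(ltW x0) ?(ltW x1).
  have [aL|caV] := H a aA an; [by left|right; split=> //].
  have /andP[ca _] := caV.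
  have ua : u < a%:R by rewrite -truncn_lt_nat// ltW.
  rewrite lef_pV2 ?posrE ?Fpos// lerD2l lerN2 -tu expRNX ler_expR lerN2.
  by rewrite ler_pM2l// ltW.
move=> P1 P2; have {P1 P2} := le_trans P2 P1.
rewrite {1}/x expRNX expRN ler_pdivrMr ?expR_gt0// => /le_trans; apply.
have E1 : (1 - x)^-1 ^+ L <= expR (eta * Num.sqrt n%:R).
  have /andP[_ T] := inv_1BexpRN_bounds R t t0.
  (* From [- ln q >= 1 - q], the inverse of [t] is at most [u * (S + M) / M = n / M + u], and both
     terms are at most [n]. *)
  have tn : t^-1 <= 2 * n%:R.
    have : (1 - q) / u <= t by rewrite /t ler_pM2r ?invr_gt0.
    rewrite -lef_pV2 ?posrE// ?divr_gt0// => /le_trans; apply.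
    rewrite q1 (_ : (_ / _ / _)^-1 = n%:R / M + u); last first.
      rewrite /S; field.
      by rewrite (gt_eqF M0) (gt_eqF u0) gt_eqF// addr_gt0// mulr_gt0.
    have -> : 2 * n%:R = n%:R + n%:R :> R by ring.
    apply: lerD; last exact: ltW.
    by rewrite ler_pdivrMr// ler_peMr// ltW.
  have T2 : (1 - x)^-1 <= expR (eta * (1 - beta) * w).
    by apply: le_trans T _; apply: le_trans wl; rewrite lerD2l.
  apply: (@le_trans _ _ (expR (eta * (1 - beta) * w) ^+ L)).
    by apply: lerXn2r; rewrite ?nnegrE ?expR_ge0// (le_trans ler01).
  rewrite -expRM_natr ler_expR -w2.
  have -> : eta * w ^+ 2 = eta * (1 - beta) * w * (w / (1 - beta)).
    by field; rewrite gt_eqF.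
  by rewrite ler_pM2l// mulr_gt0.
have E2 : (1 - q)^-1 ^+ (V - c) <= expR (- M * ln (M / (S + M))).
  have -> : (1 - q)^-1 = expR (- ln (1 - q)) by rewrite expRN lnK.
  rewrite -expRM_natr ler_expR -q1 mulNr [leRHS]mulNr lerN2 [leRHS]mulrC.
  by rewrite ler_wnM2r// ln_le0// gerBl ltW.
have E3 : expR (t * n%:R) = expR (- S * ln q).
  by congr expR; rewrite /t /S; field; rewrite gt_eqF.
apply: (@le_trans _ _ (expR (eta * Num.sqrt n%:R) * expR (- M * ln (M / (S + M))) *
  expR (- S * ln q))).
  rewrite E3 ler_pM2r ?expR_gt0//; apply: ler_pM => //.
    by rewrite exprn_ge0// (le_trans ler01).
  by rewrite exprn_ge0// (le_trans ler01).
rewrite -!expRD ler_expR [leRHS]mulrDl.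
have EB := entropy_bound R S M S0 M0; rewrite -/q in EB.
suff : 2 * ln 2 * Num.sqrt (S * M) <= 2 * ln 2 * Num.sqrt (b' / (1 - beta)) * Num.sqrt n%:R.
  by lra.
rewrite -[leRHS]mulrA ler_pM2l ?mulr_gt0// -sqrtrM; last first.
  by rewrite divr_ge0 ?ltW// (lt_trans b0).
apply: ler_wsqrtr.
(* The gap [b' - beta] absorbs [1 / V], since [V >= w > 1 / (b' - beta)]. *)
rewrite (_ : S * M = (beta + V%:R^-1) / (1 - beta) * n%:R); last first.
  by rewrite /S /M /u; field; rewrite !gt_eqF.
rewrite ler_pM2r// ler_pM2r ?invr_gt0// -lerBrDl.
rewrite -[leRHS]invrK lef_pV2 ?posrE ?invr_gt0 ?subr_gt0//.
by rewrite (le_trans (ltW wb)).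
Unshelve. all: by end_near. Qed.

Lemma limsup_log_ratio_block_set (R : realType) (beta : R) : 0 < beta -> beta < 1 ->
  (limn_esup (log_ratio (block_set R beta) beta)
     <= (ln 2 / sqrt_zeta2 R / Num.sqrt (1 - beta))%:E)%E.
Proof.
move=> b0 b1; have b10 : 0 < 1 - beta by rewrite subr_gt0.
have l2 : 0 < ln 2 :> R by rewrite ln_gt0// ltr1n.
apply: limn_esup_le_near => e e0.
have := sqrt_zeta2_gt0 R; move sE : (sqrt_zeta2 R) => s s0.
have r0 : 0 < Num.sqrt (1 - beta) by rewrite sqrtr_gt0.
have sb0 : 0 < Num.sqrt beta by rewrite sqrtr_gt0.
pose X := 2 * ln 2 * Num.sqrt beta / Num.sqrt (1 - beta).
pose Y := 2 * e * s * Num.sqrt beta.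
have X0 : 0 < X by apply: divr_gt0 => //; apply: mulr_gt0 => //; exact: mulr_gt0.
have Y0 : 0 < Y by apply: mulr_gt0 => //; apply: mulr_gt0 => //; exact: mulr_gt0.
have Z0 : 0 < 3 * X + 2 * Y + 1 by lra.
(* One parameter serves all the losses, which combine into [dXY]. This [d] makes its part of degree
   at most one in [d] an equality; the remaining [(X + Y) * d^2] is nonnegative. *)
pose d := Y / (3 * X + 2 * Y + 1).
have d0 : 0 < d by exact: divr_gt0.
have d1 : d < 1 by rewrite /d ltr_pdivrMr//; lra.
have d10 : 0 < 1 - d by rewrite subr_gt0.
have dE : d * (3 * X + 2 * Y + 1) = Y by rewrite /d divfK// gt_eqF.
have dXY : X * (1 + d) + d <= (X + Y) * (1 - d) ^+ 2.
  have := mulr_ge0 (ltW (addr_gt0 X0 Y0)) (sqr_ge0 d); nra.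
have bb : beta < beta * (1 + d) ^+ 2.
  rewrite ltr_pMr//; nra.
have ls : 2 * s * (1 - d) < 2 * sqrt_zeta2 R by rewrite sE; nra.
have l0 : 0 <= 2 * s * (1 - d) by rewrite !mulr_ge0 ?ltW.
near=> n.
have D1 : 1 < (p (Num.truncn (beta * n%:R)))%:R :> R.
  by near: n; exact: near_p_truncn_gt1.
rewrite (log_ratio_le R _ beta _ n D1).
apply: (@le_trans _ _ (expR ((2 * ln 2 * Num.sqrt (beta * (1 + d) ^+ 2 / (1 - beta)) + d)
   * Num.sqrt n%:R))).
  by near: n; exact: pA_block_set_le.
have H : 2 * s * (1 - d) * Num.sqrt (Num.truncn (beta * n%:R))%:R <=
    ln (p (Num.truncn (beta * n%:R)))%:R.
  rewrite -ler_expR lnK ?posrE ?(lt_trans _ D1)//.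
  near: n; apply: (near_truncn R beta
    (fun m => expR (2 * s * (1 - d) * Num.sqrt m%:R) <= (p m)%:R)) => //.
  exact: p_eventually_ge.
(* For large [n] the floor costs at most a factor [(1 - d)^2] inside the root. *)
have T : (1 - d) * Num.sqrt beta * Num.sqrt n%:R <= Num.sqrt (Num.truncn (beta * n%:R))%:R.
  have nb : 1 / (beta * (1 - (1 - d) ^+ 2)) < n%:R by near: n; exact: near_natr_ge.
  have -> : (1 - d) * Num.sqrt beta * Num.sqrt n%:R =
      Num.sqrt ((1 - d) ^+ 2 * beta * n%:R).
    rewrite sqrtrM; last by rewrite mulr_ge0 ?sqr_ge0// ltW.
    by rewrite sqrtrM ?sqr_ge0// sqrtr_sqr ger0_norm// ltW.
  apply: ler_wsqrtr.
  have dd : 0 < beta * (1 - (1 - d) ^+ 2) by rewrite mulr_gt0//; nra.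
  rewrite ltr_pdivrMr// in nb.
  have := truncnS_gt (beta * n%:R); rewrite -natr1; lra.
rewrite ler_expR.
set c := ln 2 / s / _ + e.
have c0 : 0 < c by rewrite addr_gt0// !divr_gt0.
apply: (@le_trans _ _ (c * (2 * s * (1 - d) * ((1 - d) * Num.sqrt beta * Num.sqrt n%:R)))); last first.
  by rewrite ler_pM2l//; apply: le_trans H; rewrite ler_wpM2l.
have -> : Num.sqrt (beta * (1 + d) ^+ 2 / (1 - beta)) =
    Num.sqrt beta * (1 + d) / Num.sqrt (1 - beta).
  have h : 0 <= beta * (1 + d) ^+ 2 by rewrite mulr_ge0 ?sqr_ge0 ?(ltW b0).
  rewrite (sqrtrM _ h) (sqrtrM _ (ltW b0)) sqrtr_sqr sqrtrV ?(ltW b10)//.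
  by rewrite ger0_norm// ltW// addr_gt0.
have -> : c * (2 * s * (1 - d) * ((1 - d) * Num.sqrt beta * Num.sqrt n%:R)) =
    (X + Y) * (1 - d) ^+ 2 * Num.sqrt n%:R.
  by rewrite /c /X /Y; field; rewrite !gt_eqF.
rewrite ler_wpM2r ?sqrtr_ge0//; apply: le_trans dXY.
by rewrite le_eqVlt /X; apply/orP; left; apply/eqP; field; rewrite gt_eqF.
Unshelve. all: by end_near. Qed.

Theorem theorem1p2 (R : realType) :
  exists eps1 eps2 : R -> R,
    (eps1 x @[x --> 0^'+] --> 0) /\
    (eps2 x @[x --> 0^'+] --> 0) /\
    forall beta : R, 0 < beta -> beta < 1 ->
      (exists A : set nat,
         A `<=` positives /\
         is_gcd A 1 /\
         upper_density R A = beta%:E /\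
         (limn_esup (log_ratio A beta)
            <= (Num.sqrt 6 * ln 2 / pi + eps1 beta)%:E)%E) /\
      (forall A : set nat,
         A `<=` positives ->
         upper_density R A = beta%:E ->
         ((Num.sqrt 6 * ln 2 / pi + eps2 beta)%:E
            <= limn_esup (log_ratio A beta))%E).
Proof.
pose rho : R := ln 2 / sqrt_zeta2 R.
have rhoE : Num.sqrt 6 * ln 2 / pi = rho.
  by rewrite /rho /sqrt_zeta2 invf_div mulrCA mulrA.
(* The first error is the excess due to the factor [1 / sqrt (1 - beta)] of the block set; the lower
   bound holds with error zero. *)
exists (fun x => rho * ((Num.sqrt (1 - x))^-1 - 1)), (fun=> 0); split.
  apply: cvg_at_right_filter.
  rewrite [X in _ --> X](_ : 0 = rho * ((Num.sqrt (1 - 0))^-1 - 1)); last first.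
    by rewrite subr0 sqrtr1 invr1 subrr mulr0.
  apply: cvgMr; apply: cvgB; last exact: cvg_cst.
  apply: cvgV; first by rewrite subr0 sqrtr1 oner_neq0.
  apply: continuous_cvg; first exact: sqrt_continuous.
  apply: cvgB; first exact: cvg_cst.
  exact: cvg_id.
split; first exact: cvg_cst.
move=> beta b0 b1; split; last first.
  by move=> A Apos dA; rewrite rhoE addr0; exact: limsup_log_ratio_ge.
exists (block_set R beta); split; first exact: block_set_positives.
split; first exact: block_set_gcd.
split; first exact: block_set_density.
rewrite rhoE mulrBr mulr1 addrC subrK; exact: limsup_log_ratio_block_set.
Qed.
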